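(* Let $\theta>0$ and $\alpha>-1$ be real. For every $n=1,2,\ldots$ and all $x_1,\ldots,x_n\in(0,+\infty)$ the following limit exists and has the indicated value: $$\lim_{N\to\infty}\frac{1}{N^{\frac n\theta}}\,\rho^{Lag}_{nN}\left(\frac{x_1}{N^{\frac1\theta}},\ldots,\frac{x_n}{N^{\frac1\theta}}\right)=\prod_{i=1}^n x_i^{\alpha}\cdot\det\left[\mathcal K^{(\alpha,\theta)}(x_i,x_j)\right]_{i,j=1}^n .$$
   Context: Biorthogonal Laguerre ensemble: for $N\ge1$, the $N$-point ensemble on $(0,+\infty)$ with joint probability density $$p^{Lag}_N(x_1,\ldots,x_N)=\mathrm{const}\cdot\prod_{1\le i<j\le N}\left[(x_i-x_j)(x_i^{\theta}-x_j^{\theta})\right]\cdot\prod_{i=1}^N x_i^{\alpha}\cdot e^{-x_1-\cdots-x_N},$$ where the constant is chosen so that the total integral over $(0,\infty)^N$ is $1$. For $n\le N$ its $n$-th correlation function is $$\rho^{Lag}_{nN}(x_1,\ldots,x_n)=\frac{N!}{(N-n)!}\int_{(0,\infty)^{N-n}}p^{Lag}_N(x_1,\ldots,x_N)\,dx_{n+1}\cdots dx_N .$$ The kernel is $$\mathcal K^{(\alpha,\theta)}(x,y)=\sum_{k,l=0}^{\infty}\frac{(-1)^{k}x^{k}}{k!\,\Gamma\left(\frac{\alpha+1+k}{\theta}\right)}\,\frac{(-1)^l y^{\theta l}}{l!\,\Gamma(\alpha+1+\theta l)}\,\frac{\theta}{\alpha+1+k+\theta l}=\theta\int_0^1 J_{\frac{\alpha+1}{\theta},\frac1\theta}(xt)\,J_{\alpha+1,\theta}\left((yt)^{\theta}\right)t^{\alpha}\,dt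 ,$$ where $J_{a,b}(x)=\sum_{m=0}^{\infty}\frac{(-x)^m}{m!\,\Gamma(a+bm)}$ for $a,b>0$. *)

(* Defs.v *)
From HB Require Import structures.
From mathcomp Require Import all_boot all_order all_algebra.
From mathcomp Require Import all_classical all_reals all_analysis.

Set Implicit Arguments.
Unset Strict Implicit.
Unset Printing Implicit Defensive.

Import Order.TTheory GRing.Theory Num.Theory.
Import numFieldNormedType.Exports.

Local Open Scope classical_set_scope.
Local Open Scope ring_scope.

(* Euler's integral, meaningful for [0 < a]. *)
Definition Gamma (R : realType) (a : R) : R :=
  \int[@lebesgue_measure R]_(t in `]0, +oo[) (t `^ (a - 1) * expR (- t)).

(* Lebesgue integral over (0, +oo)^m, as m nested one-dimensional integrals; for
   the nonnegative measurable functions used below the order of integration is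
   immaterial (Tonelli). *)
Fixpoint integral_pos (R : realType) (m : nat) :
    (m.-tuple R -> \bar R) -> \bar R :=
  match m return (m.-tuple R -> \bar R) -> \bar R with
  | 0 => fun f => f [tuple]
  | m'.+1 => fun f =>
      (\int[@lebesgue_measure R]_(t in `]0%R, +oo[)
         integral_pos (fun y : m'.-tuple R => f [tuple of (t : R) :: y]))%E
  end.

Section LaguerreEnsemble.
Variables (R : realType) (alpha theta : R).

Definition laguerre_weight (N : nat) (x : N.-tuple R) : R :=
  (\prod_(i < N) \prod_(j < N | (i < j)%N)
      ((tnth x i - tnth x j) * (tnth x i `^ theta - tnth x j `^ theta))) *
  (\prod_(i < N) tnth x i `^ alpha) *
  expR (- \sum_(i < N) tnth x i).

Definition laguerre_partition (N : nat) : R :=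
  fine (integral_pos (fun x : N.-tuple R => (laguerre_weight x)%:E)).

Definition laguerre_density (N : nat) (x : N.-tuple R) : R :=
  (laguerre_partition N)^-1 * laguerre_weight x.

(* Meaningful for [n <= N]: then [x ++ y] has exactly N entries. *)
Definition laguerre_corr (n N : nat) (x : n.-tuple R) : R :=
  N`!%:R / (N - n)`!%:R *
  fine (integral_pos (fun y : (N - n).-tuple R =>
    (laguerre_density [tuple nth 0 (x ++ y) i | i < N])%:E)).

Definition kernel_term (x y : R) (k l : nat) : R :=
  (-1) ^+ k * x ^+ k / (k`!%:R * Gamma ((alpha + 1 + k%:R) / theta)) *
  ((-1) ^+ l * y `^ (theta * l%:R) /
     (l`!%:R * Gamma (alpha + 1 + theta * l%:R))) *
  (theta / (alpha + 1 + k%:R + theta * l%:R)).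

(* The double series converges absolutely for [0 < theta], [-1 < alpha] and
   [0 < x, y], so summing over l first is only a convention. *)
Definition laguerre_kernel (x y : R) : R :=
  limn (series (fun k => limn (series (kernel_term x y k)))).

End LaguerreEnsemble.

(* Main.v *)
Require Import Defs.
From mathcomp Require Import all_boot all_order all_algebra.
From mathcomp Require Import all_classical all_reals all_analysis.
From mathcomp Require Import measurable_realfun zify ring lra.
Import Order.TTheory GRing.Theory Num.Theory.
Import numFieldNormedType.Exports.
Local Open Scope classical_set_scope.
Local Open Scope ring_scope.
Set Implicit Arguments.
Unset Strict Implicit.
Unset Printing Implicit Defensive.

(** The ensemble is determinantal, its kernel is explicit for every N, and the
    limit is taken coefficient by coefficient.

    By Vandermonde's formula the density is a constant times
    det(x_i^k) det(x_j^(theta l)) prod_j w(x_j), with w(t) = t^alpha e^(-t).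
    Inserting any invertible matrix C between the two determinants only changes
    the constant, so the density is proportional to det K_N(x_i, x_j) where
    K_N(x, y) = sum_(k, l < N) C_kl x^k y^(theta l) w(y). If C is the
    inverse of the Gram matrix Gamma(alpha + 1 + theta l + k) of the two families
    for w, then K_N reproduces itself and has trace N; expanding
    a determinant bordered by one more variable t and integrating over t
    then multiplies det K_N by N - n ([integral_det_kernel]). Integrating the
    variables out one at a time gives both the normalization and
    rho_n = det K_N(x_i, x_j) ([laguerre_corrE]).

    The inverse of the Gram matrix can be written down. Since
    Gamma(c + k) = c (c + 1) ... (c + k - 1) Gamma(c), multiplying by the Gram
    matrix is evaluating a Newton series in c. Newton's interpolation formula
    ([newton_backward]) therefore turns a polynomial into a row of coefficients, and
    the polynomial with zeros at all the nodes but one yields a row of the inverse ([gram_invP]). Its coefficients are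
    alternating sums over m <= k of prod_(j < N, j != l) (a_m + j) with
    a_m = (m + alpha + 1) / theta, and this product equals
    Gamma(a_m + N) / (Gamma(a_m) (a_m + l)).

    After the substitution x -> x / N^(1/theta) the summand of index m
    carries the power N^(a_m - a_k), so only m = k survives, and
    Gamma(N + a) ~ (N - 1)! N^a ([cvg_gamma_ratio]) gives exactly the (k, l)
    term of the limiting kernel ([cvg_scaled_term]). The elementary bound
    prod_(0 < j < N) (1 + a / j) <= e^a N^a dominates the rescaled
    (k, l) term, uniformly in N, by a constant times a term in k and a term in l
    of two exponential series ([scaled_term_le]), so that two applications of
    Tannery's theorem ([tannery]) exchange the limit with the double sum. *)

(** * An improper fundamental theorem of calculus *)

Section ImproperFTC.
Context {R : realType}.
Notation mu := (@lebesgue_measure R).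

(** The integrand may be singular at 0, so the half-line is exhausted from both
    ends by compact intervals on which the ordinary theorem applies. *)
Lemma ge0_FTC_pos (f F : R -> R) (l0 l1 : R) :
  (forall x : R, 0 < x -> 0 <= f x) ->
  (forall x : R, 0 < x -> {for x, continuous f}) ->
  (forall x : R, 0 < x -> is_derive x 1 F (f x)) ->
  F x @[x --> 0^'+] --> l0 -> F x @[x --> +oo] --> l1 ->
  (\int[mu]_(x in `]0%R, +oo[) (f x)%:E = (l1 - l0)%:E)%E.
Proof.
move=> f0 cf dF F0 F1.
(* The intervals start at [1 / (n + 1)] and end at [n + 2], so none is a point. *)
pose a n : R := n.+1%:R^-1.
pose I n := [set` `[a n, n.+2%:R : R]].
have a0 n : 0 < a n by rewrite /a invr_gt0.
have a1 n : a n < n.+2%:R.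
  by rewrite (@le_lt_trans _ _ 1)// /a ?invf_le1 ?ler1n ?ltr1n.
have IE : `]0%R, +oo[%classic = \bigcup_n I n.
  apply/seteqP; split => x /=.
    rewrite in_itv/= andbT => x0.
    exists (Num.truncn (x + x^-1)) => //=; rewrite /I /= in_itv /= /a.
    have h := truncnS_gt (x + x^-1).
    have xi : 0 < x^-1 by rewrite invr_gt0.
    apply/andP; split.
      rewrite -[leRHS]invrK lef_pV2 ?posrE// ltW// (le_lt_trans _ h)// lerDr ltW//.
    rewrite (@le_trans _ _ (Num.truncn (x + x^-1)).+1%:R) ?ler_nat//.
    by rewrite ltW// (le_lt_trans _ h)// lerDl ltW.
  by move=> [n _] /=; rewrite /I/= !in_itv/= andbT => /andP[+ _]; exact: lt_le_trans.
have cvg1 : (\int[mu]_(x in I n) (f x)%:E @[n --> \oo] -->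
    \int[mu]_(x in \bigcup_n I n) (f x)%:E)%E.
  apply: ge0_nondecreasing_set_cvg_integral.
  - move=> n m nm; rewrite /I; apply/subsetPset; apply: subset_itv.
      by rewrite bnd_simp /a lef_pV2 ?posrE// ler_nat.
    by rewrite bnd_simp ler_nat !ltnS.
  - by move=> n; exact: measurable_itv.
  - move=> n; apply/measurable_EFinP; apply: subspace_continuous_measurable_fun.
      exact: measurable_itv.
    apply: continuous_in_subspaceT => x; rewrite inE /I/= in_itv/= => /andP[ax _].
    by apply: cf; exact: lt_le_trans ax.
  - move=> n x; rewrite /I/= in_itv/= lee_fin => /andP[ax _].
    by apply: f0; exact: lt_le_trans ax.
have FTC n : (\int[mu]_(x in I n) (f x)%:E = (F n.+2%:R - F (a n))%:E)%E.
  have pos x : a n <= x -> 0 < x by exact: lt_le_trans.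
  have cF x : a n <= x -> {for x, continuous F}.
    move=> /pos/dF d; apply: differentiable_continuous.
    by apply/derivable1_diffP; exact: ex_derive.
  rewrite EFinB; apply: continuous_FTC2 => //.
  - apply: continuous_in_subspaceT => x; rewrite inE /I/= in_itv/= => /andP[ax _].
    exact/cf/pos.
  - split.
    + move=> x; rewrite in_itv/= => /andP[ax _].
      by apply: ex_derive; exact/dF/pos/ltW.
    + exact/cvg_at_right_filter/cF.
    + by apply/cvg_at_left_filter/cF; exact: ltW.
  - move=> x; rewrite in_itv/= => /andP[ax _].
    by rewrite derive1E; have [_ ->] := dF _ (pos _ (ltW ax)).
rewrite IE -(cvg_lim _ cvg1)//; apply/cvg_lim => //.
rewrite (_ : (fun n => _) = (fun n => (F n.+2%:R - F (a n))%:E)); last first.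
  by apply/funext => n; exact: FTC.
apply: cvg_EFin; first exact: nearW.
apply: cvgB.
  have := (cvg_pinftyP F l1).1 F1 (fun n => n.+2%:R); apply.
  apply/cvgryPge => A; near=> n.
  rewrite (@le_trans _ _ n%:R)//; last by rewrite ler_nat (leq_trans (leqnSn n)).
  by near: n; exact: nbhs_infty_ger.
have := (cvg_at_rightP F 0 l0).1 F0 a; apply; split => //.
exact: cvg_harmonic.
Unshelve. all: end_near. Qed.

End ImproperFTC.

(** * Integrability of Euler's integrand *)

Section GammaFunction.
Context {R : realType}.
Notation mu := (@lebesgue_measure R).
Implicit Types a s t x : R.

Definition gamma_itg a t : R := t `^ (a - 1) * expR (- t).

(** A bounded increasing function whose derivative behaves like a multiple of
    [t `^ (a - 1)] at 0; the derivative decays slowly enough at infinity to dominate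
    the integrand of [Gamma a]. *)
Definition majorant_primitive a t : R := (t / (1 + t)) `^ a.

Definition majorant a t : R :=
  a * (t / (1 + t)) `^ (a - 1) * (1 + t) ^- 2.

Lemma majorant_ge0 a t : 0 < a -> 0 < t -> 0 <= majorant a t.
Proof.
move=> a0 t0; rewrite /majorant !mulr_ge0 ?powR_ge0 ?(ltW a0)//.
by rewrite invr_ge0 exprn_ge0// addr_ge0// ltW.
Qed.

Lemma is_derive_majorant a t : 0 < t ->
  is_derive t 1 (majorant_primitive a) (majorant a t).
Proof.
move=> t0; have t1 : 1 + t != 0 by rewrite gt_eqF// addr_gt0.
have d1 : is_derive t 1 (fun u : R => u / (1 + u)) ((1 + t) ^- 2).
  have dV : is_derive t 1 (fun u : R => (1 + u)^-1) (- (1 + t) ^- 2).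
    apply: is_derive_eq.
    by rewrite /GRing.scale/= add0r mulr1.
  apply: is_derive_eq.
  by rewrite /GRing.scale/=; field.
have d2 : is_derive (t / (1 + t)) 1 (@powR R ^~ a) (a * (t / (1 + t)) `^ (a - 1)).
  by apply: is_derive1_powR; rewrite divr_gt0// addr_gt0.
have H := is_derive1_comp (f := @powR R ^~ a) (g := fun u => u / (1 + u)) d2 d1.
exact: H.
Qed.

(** Taking logarithms, this is [ln u < u] at [u = (1 + t) / b]. *)
Lemma expR_dominates b t : 0 < b -> 0 < t ->
  (1 + t) `^ b * expR (- t) <= expR (1 + b * ln b).
Proof.
move=> b0 t0; have t1 : 0 < 1 + t by rewrite addr_gt0.
rewrite /powR gt_eqF// -expRD ler_expR.
have := ln_sublinear (divr_gt0 t1 b0); rewrite ln_div ?posrE// => h.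
have : b * (ln (1 + t) - ln b) <= 1 + t.
  by rewrite mulrC -ler_pdivlMr// ltW.
lra.
Qed.

Lemma gamma_itg_le a t : 0 < a -> 0 < t ->
  gamma_itg a t <= expR (1 + (a + 1) * ln (a + 1)) / a * majorant a t.
Proof.
move=> a0 t0; have t1 : 0 < 1 + t by rewrite addr_gt0.
have a1 : 0 < a + 1 by rewrite addr_gt0.
set C := expR _.
have H : (1 + t) `^ (a - 1) * expR (- t) <= C * (1 + t) ^- 2.
  rewrite ler_pdivlMr ?exprn_gt0// mulrAC -powR_mulrn ?(ltW t1)// -powRD.
    rewrite (_ : a - 1 + 2%:R = a + 1); last by ring.
    exact: expR_dominates.
  by rewrite (gt_eqF t1) implybT.
rewrite /gamma_itg /majorant.
rewrite [leRHS](_ : _ = (t / (1 + t)) `^ (a - 1) * (C * (1 + t) ^- 2)); last first.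
  by field; rewrite !gt_eqF.
have -> : t `^ (a - 1) = (t / (1 + t)) `^ (a - 1) * (1 + t) `^ (a - 1).
  by rewrite -powRM ?divr_ge0 ?(ltW t0) ?(ltW t1)// divfK// gt_eqF.
by rewrite -mulrA; apply: ler_wpM2l => //; exact: powR_ge0.
Qed.

Lemma cvg_majorant0 a : 0 < a -> majorant_primitive a t @[t --> 0^'+] --> 0.
Proof.
move=> a0; apply: (squeeze_cvgr (f := fun=> 0) (h := @powR R ^~ a)).
- near=> t; have t0 : 0 < t by near: t; exact: nbhs_right_gt.
  have t1 : 0 < 1 + t by rewrite addr_gt0.
  rewrite powR_ge0/= ge0_ler_powR ?nnegrE ?divr_ge0 ?(ltW t0) ?(ltW t1) ?(ltW a0)//.
  by rewrite ler_pdivrMr// ler_peMr ?(ltW t0)// lerDl ltW.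
- exact: cvg_cst.
- exact: powR_cvg0.
Unshelve. all: end_near. Qed.

Lemma cvg_inv1Dy : (1 + t)^-1 @[t --> +oo] --> (0 : R).
Proof.
apply/gtr0_cvgV0.
  by near=> t; rewrite addr_gt0//; near: t; exact: nbhs_pinfty_gt.
apply/cvgryPge => A; near=> t.
rewrite -lerBlDl; near: t; apply: nbhs_pinfty_ge; exact: num_real.
Unshelve. all: end_near. Qed.

Lemma continuous_powR_pos a t : 0 < t -> {for t, continuous (@powR R ^~ a)}.
Proof.
move=> t0; apply: differentiable_continuous; apply/derivable1_diffP.
by apply: derivable_powR; rewrite in_itv/= t0.
Qed.

Lemma cvg_majorant1 a : majorant_primitive a t @[t --> +oo] --> (1 : R).
Proof.
have c1 := @continuous_powR_pos a _ (ltr01 : 0 < 1 :> R).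
have e1 : 1 `^ a = 1 :> R by rewrite powR1.
rewrite /majorant_primitive -[X in _ --> X]e1.
apply: (@cvg_comp _ _ _ (fun t => t / (1 + t)) (@powR R ^~ a) _ _ _ _ c1).
have h : (1 - (1 + t)^-1) @[t --> +oo] --> (1 : R).
  by rewrite -[X in _ --> X]subr0; apply: cvgB; [exact: cvg_cst|exact: cvg_inv1Dy].
apply: cvg_trans h; apply: near_eq_cvg; near=> t.
have t0 : 0 < t by near: t; exact: nbhs_pinfty_gt.
by field; rewrite gt_eqF// addr_gt0.
Unshelve. all: end_near. Qed.

Lemma continuous_gamma_itg a t : 0 < t -> {for t, continuous (gamma_itg a)}.
Proof.
move=> t0; apply: cvgM; first exact: continuous_powR_pos.
by apply: continuous_comp; [exact: cvgN|exact: continuous_expR].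
Qed.

Lemma continuous_majorant a t : 0 < t -> {for t, continuous (majorant a)}.
Proof.
move=> t0; have t1 : 0 < 1 + t by rewrite addr_gt0.
have cD : (1 + u) @[u --> t] --> 1 + t by apply: cvgD; [exact: cvg_cst|exact: cvg_id].
apply: cvgM; last first.
  apply: cvgV; first by rewrite gt_eqF// exprn_gt0.
  by rewrite expr2; under eq_fun do rewrite expr2; exact: cvgM.
apply: cvgM; first exact: cvg_cst.
apply: (@cvg_comp _ _ _ (fun t => t / (1 + t)) (@powR R ^~ (a - 1)) _
  (nbhs (t / (1 + t)))).
  apply: cvgM; first exact: cvg_id.
  by apply: cvgV; rewrite ?gt_eqF.
by apply: continuous_powR_pos; rewrite divr_gt0.
Qed.

Lemma integral_majorant a : 0 < a ->
  (\int[mu]_(t in `]0%R, +oo[) (majorant a t)%:E = 1)%E.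
Proof.
move=> a0; have := @ge0_FTC_pos _ (majorant a) (majorant_primitive a) 0 1.
rewrite subr0; apply.
- by move=> x; exact: majorant_ge0.
- by move=> x; exact: continuous_majorant.
- by move=> x; exact: is_derive_majorant.
- exact: cvg_majorant0.
- exact: cvg_majorant1.
Qed.

Lemma measurable_EFin_pos (f : R -> R) :
  (forall x, 0 < x -> {for x, continuous f}) ->
  measurable_fun (`]0, +oo[%classic : set R) (EFin \o f).
Proof.
move=> cf; apply/measurable_EFinP; apply: open_continuous_measurable_fun.
  exact: interval_open.
by move=> x; rewrite inE/= in_itv/= andbT; exact: cf.
Qed.

Lemma integrable_majorant a : 0 < a ->
  mu.-integrable `]0, +oo[ (EFin \o majorant a).
Proof.
move=> a0; apply/integrableP; split.
  by apply: measurable_EFin_pos => x; exact: continuous_majorant.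
rewrite [ltLHS](_ : _ = 1%E) ?ltry// -(integral_majorant a0).
apply: eq_integral => t; rewrite inE/= in_itv/= andbT => t0.
by rewrite ger0_norm// majorant_ge0.
Qed.

Lemma integrable_gamma_itg a : 0 < a ->
  mu.-integrable `]0, +oo[ (EFin \o gamma_itg a).
Proof.
move=> a0; set C := expR (1 + (a + 1) * ln (a + 1)) / a.
have h : mu.-integrable `]0, +oo[ (fun t => (C%:E * (EFin \o majorant a) t)%E).
  exact/integrableZl/integrable_majorant.
apply: le_integrable h => //.
- by apply: measurable_EFin_pos => x; exact: continuous_gamma_itg.
- move=> t; rewrite /= in_itv/= andbT => t0.
  rewrite /= lee_fin ger0_norm ?mulr_ge0 ?powR_ge0 ?expR_ge0//.
  rewrite ger0_norm ?gamma_itg_le// mulr_ge0 ?majorant_ge0//.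
  by rewrite divr_ge0 ?expR_ge0 ?(ltW a0).
Qed.

Lemma GammaE a : Gamma a = \int[mu]_(t in `]0%R, +oo[) gamma_itg a t.
Proof. by []. Qed.

Lemma EFin_Gamma a : 0 < a ->
  (\int[mu]_(t in `]0%R, +oo[) (gamma_itg a t)%:E = (Gamma a)%:E)%E.
Proof.
move=> a0; rewrite GammaE /Rintegral fineK//.
exact/integrable_fin_num/integrable_gamma_itg.
Qed.

End GammaFunction.

(** * The functional equation and bounds for Gamma *)

Section GammaProperties.
Context {R : realType}.
Notation mu := (@lebesgue_measure R).
Implicit Types a s t x : R.

Lemma gamma_itg_ge0 a t : 0 <= gamma_itg a t.
Proof. by rewrite mulr_ge0 ?powR_ge0 ?expR_ge0. Qed.

Lemma cvg_expRNy : expR (- t) @[t --> +oo] --> (0 : R).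
Proof.
apply: (squeeze_cvgr (f := fun=> 0) (h := fun t => (1 + t)^-1)).
- near=> t; have t0 : 0 < t by near: t; exact: nbhs_pinfty_gt.
  rewrite expR_ge0/= expRN lef_pV2 ?posrE ?expR_gt0 ?addr_gt0//.
  exact: expR_ge1Dx.
- exact: cvg_cst.
- exact: cvg_inv1Dy.
Unshelve. all: end_near. Qed.

Lemma is_derive_expRN t : is_derive t 1 (fun u : R => expR (- u)) (- expR (- t)).
Proof.
have d1 : is_derive t 1 (fun u : R => - u) (- 1) by exact: is_deriveN.
have d2 := is_derive1_comp (f := expR) (g := fun u : R => - u)
  (is_derive_expR (- t)) d1.
by rewrite mulrN1 in d2.
Qed.

Lemma Gamma1 : Gamma 1 = 1 :> R.
Proof.
apply: EFin_inj; rewrite -EFin_Gamma//.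
have := @ge0_FTC_pos _ (gamma_itg 1) (fun t => - expR (- t)) (- 1) 0.
rewrite sub0r opprK; apply.
- by move=> x _; exact: gamma_itg_ge0.
- by move=> x; exact: continuous_gamma_itg.
- move=> x x0; rewrite /gamma_itg subrr powRr0 mul1r -[X in is_derive _ _ _ X]opprK.
  exact: is_deriveN (is_derive_expRN x).
- have e1 : expR (- 0) = 1 :> R by rewrite oppr0 expR0.
  apply: cvgN; rewrite -[X in _ --> X]e1.
  apply: cvg_at_right_filter.
  apply: (@cvg_comp _ _ _ (fun t : R => - t) expR _ (nbhs (- 0))).
    by apply: cvgN; exact: cvg_id.
  exact: continuous_expR.
- by rewrite -[X in _ --> X]oppr0; apply: cvgN; exact: cvg_expRNy.
Qed.

Lemma cvg_gamma_itg0 a : 0 < a -> gamma_itg (a + 1) t @[t --> 0^'+] --> 0.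
Proof.
move=> a0; apply: (squeeze_cvgr (f := fun=> 0) (h := @powR R ^~ a)).
- near=> t; have t0 : 0 < t by near: t; exact: nbhs_right_gt.
  rewrite gamma_itg_ge0/= /gamma_itg addrK ler_piMr ?powR_ge0// -expR0 ler_expR.
  by rewrite oppr_le0 ltW.
- exact: cvg_cst.
- exact: powR_cvg0.
Unshelve. all: end_near. Qed.

Lemma cvg_gamma_itgy a : 0 < a -> gamma_itg (a + 1) t @[t --> +oo] --> 0.
Proof.
move=> a0; pose C : R := expR (1 + (a + 1) * ln (a + 1)).
apply: (squeeze_cvgr (f := fun=> 0) (h := fun t => C * (1 + t)^-1)).
- near=> t; have t0 : 0 < t by near: t; exact: nbhs_pinfty_gt.
  have t1 : 0 < 1 + t by rewrite addr_gt0.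
  rewrite gamma_itg_ge0/= /gamma_itg addrK ler_pdivlMr// mulrAC.
  have a1 : 0 < a + 1 by rewrite addr_gt0.
  apply: le_trans (expR_dominates a1 t0); rewrite ler_wpM2r ?expR_ge0//.
  rewrite powRD ?(gt_eqF t1) ?implybT// powRr1 ?(ltW t1)// ler_wpM2r ?(ltW t1)//.
  by rewrite ge0_ler_powR ?nnegrE ?(ltW a0) ?(ltW t0) ?(ltW t1)// lerDr.
- exact: cvg_cst.
- by rewrite -[X in _ --> X](mulr0 C); apply: cvgM; [exact: cvg_cst|exact: cvg_inv1Dy].
Unshelve. all: end_near. Qed.

Notation D := (`]0, +oo[%classic : set R).

Lemma integrable_posZ (k : R) (f : R -> R) : mu.-integrable D (EFin \o f) ->
  mu.-integrable D (EFin \o (fun t => k * f t)).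
Proof. by move=> h; have := integrableZl _ k h; apply; exact: measurable_itv. Qed.

Lemma integrable_posD (f g : R -> R) : mu.-integrable D (EFin \o f) ->
  mu.-integrable D (EFin \o g) -> mu.-integrable D (EFin \o (fun t => f t + g t)).
Proof. by move=> h k; have := integrableD _ h k; apply; exact: measurable_itv. Qed.

Lemma integrable_posB (f g : R -> R) : mu.-integrable D (EFin \o f) ->
  mu.-integrable D (EFin \o g) -> mu.-integrable D (EFin \o (fun t => f t - g t)).
Proof. by move=> h k; have := integrableB _ h k; apply; exact: measurable_itv. Qed.

(** Integration by parts: [gamma_itg (a + 1)] is a primitive of
    [a * gamma_itg a - gamma_itg (a + 1)] vanishing at both ends. *)
Lemma GammaS a : 0 < a -> Gamma (a + 1) = a * Gamma a.
Proof.
move=> a0; have a1 : 0 < a + 1 by rewrite addr_gt0.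
(* Adding a multiple of a majorant of known integral makes the integrand
   nonnegative. *)
pose C : R := expR (1 + (a + 1 + 1) * ln (a + 1 + 1)) / (a + 1).
pose f t := a * gamma_itg a t - gamma_itg (a + 1) t + C * majorant (a + 1) t.
pose F t := gamma_itg (a + 1) t + C * majorant_primitive (a + 1) t.
have C0 : 0 <= C by rewrite divr_ge0 ?expR_ge0// ltW.
have h : (\int[mu]_(t in `]0%R, +oo[) (f t)%:E = C%:E)%E.
  have := @ge0_FTC_pos _ f F 0 C; rewrite subr0; apply.
  - move=> x x0; rewrite /f -addrA addr_ge0 ?(mulr_ge0 (ltW a0)) ?gamma_itg_ge0//.
    by rewrite addrC subr_ge0; exact: (gamma_itg_le a1).
  - move=> x x0; apply: cvgD; last first.
      by apply: cvgM; [exact: cvg_cst|exact: continuous_majorant].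
    apply: cvgB; last exact: continuous_gamma_itg.
    by apply: cvgM; [exact: cvg_cst|exact: continuous_gamma_itg].
  - move=> x x0; have d1 := is_derive_expRN x.
    have d2 := is_derive_majorant (a + 1) x0.
    have d3 : is_derive x 1 (@powR R ^~ a) (a * x `^ (a - 1)) by exact: is_derive1_powR.
    have := is_deriveD (is_deriveM d3 d1) (is_deriveZ C d2).
    rewrite (_ : (_ + _ : R -> R) = F); last first.
      by apply/funext => t; rewrite /F /gamma_itg addrK.
    rewrite (_ : _ + _ = f x)//.
    rewrite /f /gamma_itg addrK /GRing.scale/=; ring.
  - rewrite -[X in _ --> X]addr0; apply: cvgD; first exact: cvg_gamma_itg0.
    rewrite -[X in _ --> X](mulr0 C).
    by apply: cvgM; [exact: cvg_cst|exact: cvg_majorant0].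
  - rewrite -[X in _ --> X]add0r; apply: cvgD; first exact: cvg_gamma_itgy.
    by rewrite -[X in _ --> X]mulr1; apply: cvgM; [exact: cvg_cst|exact: cvg_majorant1].
have iM := @integrable_majorant R _ a1.
have i0 := @integrable_gamma_itg R _ a0.
have i1 := @integrable_gamma_itg R _ a1.
have h2 : \int[mu]_(t in D) f t = a * Gamma a - Gamma (a + 1) + C.
  have IM : \int[mu]_(t in D) majorant (a + 1) t = 1.
    by rewrite /Rintegral integral_majorant.
  have ia : mu.-integrable D (EFin \o (fun t => a * gamma_itg a t)).
    exact: integrable_posZ.
  have iab : mu.-integrable D
      (EFin \o (fun t => a * gamma_itg a t - gamma_itg (a + 1) t)).
    exact: integrable_posB.
  have iC : mu.-integrable D (EFin \o (fun t => C * majorant (a + 1) t)).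
    exact: integrable_posZ.
  by rewrite RintegralD// RintegralB// !RintegralZl// IM mulr1.
move: h2; rewrite /Rintegral h/= => /eqP; rewrite -subr_eq subrr eq_sym subr_eq0.
by move=> /eqP.
Qed.

(** The convexity of [expR] between [0] and [ln u], obtained by averaging two
    instances of the tangent-line inequality at [f * ln u]. *)
Lemma weighted_AMGM (u f : R) : 0 < u -> 0 <= f <= 1 -> u `^ f <= 1 - f + f * u.
Proof.
move=> u0 /andP[f0 f1]; pose v := ln u; pose c := f * v.
have tan (x : R) : expR c * (1 + (x - c)) <= expR x.
  rewrite -[X in _ <= expR X](subrK c) expRD mulrC ler_wpM2r ?expR_ge0//.
  exact: expR_ge1Dx.
have := lerD (ler_wpM2l f0 (tan v)) (ler_wpM2l (_ : 0 <= 1 - f) (tan 0)).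
rewrite subr_ge0 f1 expR0 lnK ?posrE// => /(_ isT).
rewrite [X in X <= _ -> _](_ : _ = expR c); last by rewrite /c; ring.
by rewrite /powR gt_eqF// mulr1 addrC.
Qed.

(** The log-convexity of [Gamma] in the only form needed below. Integrating the
    weighted AM-GM inequality for [t / s] against the integrand of [Gamma s]
    gives [s `^ f * ((1 - f) * Gamma s + f / s * Gamma (s + 1))], which is the
    right-hand side by the functional equation. *)
Lemma le_Gamma_shift s f : 0 < s -> 0 <= f <= 1 ->
  Gamma (s + f) <= s `^ f * Gamma s.
Proof.
move=> s0 f01; have /andP[f0 f1] := f01.
have s1 : 0 < s + 1 by rewrite addr_gt0.
have sf : 0 < s + f by rewrite ltr_wpDr.
have i0 := @integrable_gamma_itg R _ s0.
have i1 := @integrable_gamma_itg R _ s1.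
pose g t := s `^ f * ((1 - f) * gamma_itg s t + f / s * gamma_itg (s + 1) t).
have ig1 : mu.-integrable D (EFin \o (fun t => (1 - f) * gamma_itg s t)).
  exact: integrable_posZ.
have ig2 : mu.-integrable D (EFin \o (fun t => f / s * gamma_itg (s + 1) t)).
  exact: integrable_posZ.
have ig3 : mu.-integrable D
    (EFin \o (fun t => (1 - f) * gamma_itg s t + f / s * gamma_itg (s + 1) t)).
  exact: integrable_posD.
have -> : s `^ f * Gamma s = \int[mu]_(t in D) g t.
  rewrite RintegralZl// RintegralD// !RintegralZl// -!GammaE GammaS//.
  by congr (_ * _); field; rewrite gt_eqF.
rewrite GammaE; apply: le_Rintegral => //.
- exact: integrable_gamma_itg.
- exact: integrable_posZ.
- move=> t; rewrite /D/= in_itv/= andbT => t0.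
  have ts : 0 < t / s by rewrite divr_gt0.
  rewrite /g /gamma_itg addrK.
  have -> : t `^ (s + f - 1) = t `^ (s - 1) * (s `^ f * (t / s) `^ f).
    rewrite -powRM ?(ltW s0) ?(ltW ts)// mulrCA divff ?gt_eqF// mulr1 -powRD.
      by congr (_ `^ _); ring.
    by rewrite (gt_eqF t0) implybT.
  have -> : t `^ s = t `^ (s - 1) * t.
    by rewrite mulrC mulr_powRB1// ltW.
  rewrite [leRHS](_ : _ = t `^ (s - 1) * (s `^ f * (1 - f + f * (t / s))) *
    expR (- t)); last by field; rewrite gt_eqF.
  rewrite ler_wpM2r ?expR_ge0// ler_wpM2l ?powR_ge0// ler_wpM2l ?powR_ge0//.
  exact: weighted_AMGM.
Qed.

(** For [a] in [0, 1] compare [a + 1] with 2 by [le_Gamma_shift], where [Gamma 2 = 1];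
    beyond, the functional equation multiplies by a factor at least 1. *)
Lemma Gamma_ge_half a : 0 <= a -> 2^-1 <= Gamma (a + 1).
Proof.
have base (b : R) : 0 <= b <= 1 -> 2^-1 <= Gamma (b + 1).
  move=> /andP[b0 b1].
  have s0 : 0 < b + 1 by rewrite ltr_wpDl.
  have := @le_Gamma_shift (b + 1) (1 - b) s0; rewrite subr_ge0 b1 gerBl b0 => /(_ isT).
  rewrite (_ : b + 1 + (1 - b) = 1 + 1); last by ring.
  rewrite (GammaS (ltr01 : 0 < 1 :> R)) Gamma1 mulr1 => h.
  have : (b + 1) `^ (1 - b) <= 2.
    apply: (@le_trans _ _ (b + 1)); last by lra.
    rewrite -[leRHS]powRr1 ?(ltW s0)//; apply: ler_powR; lra.
  have p : 0 < (b + 1) `^ (1 - b) by exact: powR_gt0.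
  have G0 : 0 <= Gamma (b + 1).
    by apply: Rintegral_ge0 => t _; exact: gamma_itg_ge0.
  nra.
have [m] : exists m : nat, a <= m.+1%:R.
  by exists (Num.truncn a); exact/ltW/truncnS_gt.
elim: m a => [|m ih] a am a0; first by apply: base; rewrite a0.
have [a1|a1] := leP a 1; first by apply: base; rewrite a0.
rewrite -{1}(subrK 1 a) GammaS; last by lra.
have h : 2^-1 <= Gamma (a - 1 + 1).
  by apply: ih; [move: am; rewrite -[m.+2]addn1 natrD; lra|lra].
rewrite subrK in h *; nra.
Qed.

Lemma Gamma_gt0 a : 0 < a -> 0 < Gamma a.
Proof.
move=> a0; have := Gamma_ge_half (ltW a0); rewrite GammaS// => h.
by rewrite -(pmulr_rgt0 _ a0); lra.
Qed.

End GammaProperties.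

(** * Alternating differences and Newton's formula *)

Section Newton.
Context {F : numFieldType}.
Implicit Types (p q : {poly F}) (c : F) (k : nat).

(** The k-th forward difference of [p] at 0, up to the sign [(-1) ^+ k]. *)
Definition altdiff k p : F :=
  \sum_(m < k.+1) (-1) ^+ m * 'C(k, m)%:R * p.[m%:R].

Definition rising c k : F := \prod_(j < k) (c + j%:R).

Lemma risingS c k : rising c k.+1 = rising c k * (c + k%:R).
Proof. by rewrite /rising big_ord_recr. Qed.

Lemma altdiffD k p q : altdiff k (p + q) = altdiff k p + altdiff k q.
Proof.
by rewrite -big_split; apply: eq_bigr => m _; rewrite hornerD mulrDr.
Qed.

Lemma altdiffMc k p c : altdiff k (p * c%:P) = altdiff k p * c.
Proof.
by rewrite mulr_suml; apply: eq_bigr => m _; rewrite hornerM hornerC mulrA.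
Qed.

Lemma altdiffC k c : altdiff k c%:P = (k == 0%N)%:R * c.
Proof.
have -> : (k == 0%N)%:R = (1 - 1) ^+ k :> F by rewrite subrr expr0n.
rewrite exprDn mulr_suml; apply: eq_bigr => m _.
by rewrite hornerC expr1n mul1r mulr_natr.
Qed.

(** The difference operator analogue of the Leibniz rule for multiplication by the
    variable; it reduces statements about [altdiff] to an induction on
    polynomials. *)
Lemma altdiffMX k p :
  altdiff k (p * 'X) = k%:R * (altdiff k p - altdiff k.-1 p).
Proof.
case: k => [|k]; first by rewrite /altdiff big_ord1 hornerMX !mulr0 mul0r.
have -> : altdiff k p = \sum_(m < k.+2) (-1) ^+ m * 'C(k, m)%:R * p.[m%:R].
  by rewrite big_ord_recr/= bin_small// mulr0 mul0r addr0.
rewrite -sumrB mulr_sumr; apply: eq_bigr => -[m /= mk] _.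
have e : (k.+1%:R * 'C(k, m)%:R = (k.+1%:R - m%:R) * 'C(k.+1, m)%:R :> F).
  by rewrite -natrB// -!natrM (mul_bin_down k.+1 m).
rewrite hornerMX.
transitivity ((-1) ^+ m * p.[m%:R] *
    (k.+1%:R * 'C(k.+1, m)%:R - k.+1%:R * 'C(k, m)%:R)); last by ring.
by rewrite e; ring.
Qed.

Lemma altdiff_small k p : (size p <= k)%N -> altdiff k p = 0.
Proof.
elim/poly_ind: p k => [|p c ih] k.
  by rewrite /altdiff big1// => m _; rewrite horner0 mulr0.
rewrite size_MXaddC; case: ifP => [/andP[/eqP -> /eqP ->] _|_ pk].
  by rewrite mul0r add0r altdiffC mulr0.
rewrite altdiffD altdiffC altdiffMX !ih; [|by case: k pk|exact: ltnW].
by case: k pk => // k _; rewrite subrr mulr0 mul0r addr0.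
Qed.

(** Newton's interpolation formula, evaluated at [- c], where the binomial
    coefficient of [- c] over k is [(-1) ^+ k * rising c k / k`!]. Dividing by
    ['X + c] writes [p] as [q * ('X + c)] plus the constant [p.[- c]]. The constant
    contributes only to the term of index 0, and by [altdiffMX] the contribution
    of [q * ('X + c)] telescopes to a difference of order exceeding the
    degree of [q]. *)
Lemma newton_backward N p c : (size p <= N)%N ->
  \sum_(k < N) rising c k / k`!%:R * altdiff k p = p.[- c].
Proof.
case: N => [|N] sp.
  by move: sp; rewrite leqn0 size_poly_eq0 => /eqP ->; rewrite big_ord0 horner0.
have /factor_theorem[q pq] : root (p - p.[- c]%:P) (- c).
  by rewrite /root hornerD hornerN hornerC subrr.
have {pq} pE : p = q * 'X + q * c%:P + p.[- c]%:P.
  by rewrite -mulrDr -[LHS](subrK p.[- c]%:P) pq rmorphN opprK.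
have sq : (size q <= N)%N.
  have [->|q0] := eqVneq q 0; first by rewrite size_poly0.
  have : (size (q * ('X + c%:P))%R <= N.+1)%N.
    have -> : q * ('X + c%:P) = p - p.[- c]%:P.
      by rewrite {1}pE mulrDr addrK.
    apply: (leq_trans (size_polyD _ _)); rewrite geq_max sp size_polyN.
    by rewrite (leq_trans (size_polyC_leq1 _)).
  by rewrite size_Mmonic ?monicXaddC// size_XaddC addn2.
(* The index is shifted so that [u] starts at 0 and the sum telescopes. *)
pose u k := if k is k'.+1 then rising c k / k'`!%:R * altdiff k' q else 0.
have term k : rising c k / k`!%:R * altdiff k p =
    u k.+1 - u k + (k == 0%N)%:R * p.[- c].
  rewrite {1}pE !altdiffD altdiffC altdiffMX altdiffMc /u risingS.
  case: k => [|k]; first by rewrite /rising big_ord0 fact0/= mul0r; field.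
  rewrite /= mul0r !addr0 factS natrM.
  have f0 : k`!%:R != 0 :> F by rewrite pnatr_eq0 -lt0n fact_gt0.
  have k0 : k.+1%:R != 0 :> F by rewrite pnatr_eq0.
  by field; rewrite f0 nat1r k0.
under eq_bigr do rewrite term.
rewrite big_split/= -(big_mkord xpredT (fun k => u k.+1 - u k))/= telescope_sumr//.
rewrite big_ord_recl/= big1 ?addr0 ?mul1r; last by move=> i _; rewrite mul0r.
by rewrite subr0 altdiff_small// mulr0 add0r.
Qed.

End Newton.

(** * The inverse of the Gram matrix *)

Lemma natf_neq0 (F : numFieldType) n : n`!%:R != 0 :> F.
Proof. by rewrite pnatr_eq0 -lt0n fact_gt0. Qed.

Lemma natr_fact (F : numFieldType) n : n`!%:R = \prod_(i < n) i.+1%:R :> F.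
Proof. by rewrite fact_prod big_add1 big_mkord natr_prod. Qed.

Lemma prod_diff (F : numFieldType) N l : (l < N)%N ->
  \prod_(j < N | j != l :> nat) (j%:R - l%:R) =
    (-1) ^+ l * l`!%:R * (N - l.+1)`!%:R :> F.
Proof.
move=> lN.
rewrite -(big_mkord (fun j => j != l) (fun j => j%:R - l%:R)).
rewrite (big_cat_nat (n := l)) ?(ltnW lN)//=; congr (_ * _).
  rewrite big_mkord (eq_bigl xpredT); last by move=> j; rewrite ltn_eqF.
  rewrite (reindex_inj rev_ord_inj)/= natr_fact.
  rewrite -[X in (-1) ^+ X](card_ord l) -prodr_const -big_split/=.
  apply: eq_bigr => j _; rewrite natrB ?ltn_ord//; ring.
rewrite big_ltn_cond// eqxx/= big_add1.
rewrite -{1}(add0n l) -{1}(subnK lN).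
rewrite (_ : (N - l.+1 + l.+1).-1 = N - l.+1 + l)%N; last by rewrite addnS.
rewrite big_addn addnK big_mkord natr_fact.
apply: eq_big => [j|j _]; first by rewrite gtn_eqF// ltnS leq_addl.
by rewrite -addSn natrD addrK.
Qed.

Section Gram.
Context {R : realType} (alpha theta : R).
Hypotheses (theta_gt0 : 0 < theta) (alpha_gtN1 : -1 < alpha).

Lemma Gamma_rising (c : R) k : 0 < c -> Gamma (c + k%:R) = rising c k * Gamma c.
Proof.
move=> c0; elim: k => [|k ih]; first by rewrite addr0 /rising big_ord0 mul1r.
rewrite -natr1 addrA GammaS ?ltr_wpDr// ih risingS; ring.
Qed.

Definition node (m : nat) : R := (m%:R + (alpha + 1)) / theta.

(** The Lagrange polynomial, up to a factor, of index [l] for the nodes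
    [- (alpha + 1 + theta * j)] with [j < N]. *)
Definition nodal_poly (N l : nat) : {poly R} :=
  \prod_(j < N | j != l :> nat)
    (theta^-1 *: ('X + (alpha + 1)%:P) + j%:R%:P).

Lemma horner_nodal N l x : (nodal_poly N l).[x] =
  \prod_(j < N | j != l :> nat) ((x + (alpha + 1)) / theta + j%:R).
Proof. by rewrite horner_prod; apply: eq_bigr => j _; rewrite !hornerE mulrC. Qed.

Lemma size_nodal N l : (l < N)%N -> (size (nodal_poly N l) <= N)%N.
Proof.
move=> lN; apply: leq_trans (size_prod_leq _ _) _.
set S := (\sum_(i | _) _)%N; set c := #|_|.
have cE : c = N.-1.
  have := cardC1 (Ordinal lN); rewrite card_ord => <-.
  by apply: eq_card => j; rewrite !inE.
have : (S <= c * 2)%N.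
  rewrite /S -sum_nat_const; apply: leq_sum => j _.
  rewrite (leq_trans (size_polyD _ _))// geq_max.
  rewrite (leq_trans (size_scale_leq _ _)) ?size_XaddC//.
  exact: leq_trans (size_polyC_leq1 _) _.
by rewrite cE; case: (N) lN => // n _ /=; lia.
Qed.

Definition moment (l : nat) : R := Gamma (alpha + 1 + theta * l%:R).

(** The entries of the inverse of the Gram matrix of the monomials [t ^+ k] and the
    powers [t `^ (theta * l)] for the weight [t `^ alpha * expR (- t)]. *)
Definition gram_inv (N l k : nat) : R :=
  (-1) ^+ l / (k`!%:R * l`!%:R * (N - l.+1)`!%:R * moment l) *
  altdiff k (nodal_poly N l).

Lemma moment_arg_gt0 l : 0 < alpha + 1 + theta * l%:R.
Proof.
by rewrite ltr_wpDr ?mulr_ge0 ?(ltW theta_gt0)//; have := alpha_gtN1; lra.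
Qed.

(** Factoring [Gamma c] out of [Gamma (c + k)] leaves the Newton series of
    [nodal_poly N l] at [- c], and this polynomial vanishes at all the nodes except
    the one of index [l]. *)
Lemma gram_invP N l l' : (l < N)%N -> (l' < N)%N ->
  \sum_(k < N) gram_inv N l k * Gamma (alpha + 1 + theta * l'%:R + k%:R) =
  (l == l')%:R.
Proof.
move=> lN l'N; set c := alpha + 1 + theta * l'%:R.
have mnz j : moment j != 0 by rewrite gt_eqF// Gamma_gt0// moment_arg_gt0.
pose d : R := (-1) ^+ l / (l`!%:R * (N - l.+1)`!%:R * moment l) * moment l'.
transitivity (d * (nodal_poly N l).[- c]).
  rewrite -(newton_backward (N := N) c (size_nodal lN)) mulr_sumr.
  apply: eq_bigr => k _; rewrite Gamma_rising ?moment_arg_gt0// -/(moment l').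
  by rewrite /gram_inv /d; field; rewrite !natf_neq0 mnz.
rewrite horner_nodal.
under eq_bigr => j _.
  rewrite (_ : _ + _ = j%:R - l'%:R); last by rewrite /c; field; rewrite gt_eqF.
  over.
rewrite {}/d; have [<-|ll'] := eqVneq l l'; last first.
  rewrite (bigD1 (Ordinal l'N))/= ?(eq_sym l')// subrr mul0r mulr0//.
rewrite prod_diff//.
rewrite [LHS](_ : _ = (-1) ^+ l * (-1) ^+ l); last by field; rewrite !natf_neq0 mnz.
by rewrite -exprMn mulrNN mulr1 expr1n.
Qed.

End Gram.

(** * Bordered determinants and integrals over the positive orthant *)

Section BorderedDeterminant.

(** Multiplying on the right by a block triangular matrix of determinant [\det A]
    clears the block above the corner, which gives the identity multiplied by
    [\det A]. *)
Lemma det_bordered_reg (D : idomainType) n (A : 'M[D]_n) (b : 'cV_n) (c : 'rV_n)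
    (d : D) : \det A != 0 ->
  \det (block_mx A b c d%:M) = d * \det A - (c *m \adj A *m b) 0 0.
Proof.
move=> A0; apply: (mulIf A0).
have e : \det (block_mx (1%:M : 'M[D]_n) (- (\adj A *m b)) 0 (\det A)%:M) = \det A.
  by rewrite det_ublock det1 mul1r det_scalar1.
rewrite -[X in _ * X = _]e.
rewrite -det_mulmx mulmx_block !mulmx1 !mulmx0 !addr0.
rewrite !mulmxN !mulmxA mul_mx_adj mul_mx_scalar mul_scalar_mx addNr.
rewrite det_lblock mulrC -scalar_mxM; congr (_ * _).
by rewrite det_mx11 !mxE eqxx mulr1n addrC.
Qed.

(** The identity is polynomial in the entries of [A], so it suffices to prove it for
    the generic perturbation ['X + A], whose determinant is monic, and
    to specialize at 0. *)
Lemma det_bordered (F : fieldType) n (A : 'M[F]_n) (b : 'cV_n) (c : 'rV_n)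
    (d : F) :
  \det (block_mx A b c d%:M) = d * \det A - (c *m \adj A *m b) 0 0.
Proof.
(* [P] is ['X + A]. *)
pose P := char_poly_mx (- A).
have evC m1 m2 (B : 'M[F]_(m1, m2)) : map_mx (horner_eval (0 : F)) (map_mx polyC B) = B.
  by apply/matrixP => i j; rewrite !mxE /horner_eval hornerC.
have PE : map_mx (horner_eval (0 : F)) P = A.
  apply/matrixP => i j; rewrite !mxE /horner_eval.
  by rewrite !hornerE hornerMn hornerX mul0rn sub0r opprK.
have P0 : \det P != 0 by rewrite -/(char_poly _) monic_neq0// char_poly_monic.
have := congr1 (horner_eval (0 : F))
  (det_bordered_reg (map_mx polyC b) (map_mx polyC c) d%:P P0).
rewrite -det_map_mx map_block_mx !evC PE.
have -> : map_mx (horner_eval (0 : F)) (d%:P)%:M = d%:M :> 'M[F]_1.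
  by apply/matrixP => i j; rewrite !mxE /horner_eval hornerMn hornerC.
move=> ->; rewrite rmorphB rmorphM -det_map_mx PE.
congr (_ * _ - _); first by rewrite /= /horner_eval hornerC.
transitivity (map_mx (horner_eval (0 : F))
    (map_mx polyC c *m \adj P *m map_mx polyC b) 0 0); first by rewrite [RHS]mxE.
by rewrite !map_mxM !evC map_mx_adj PE.
Qed.

End BorderedDeterminant.

Section IntegralPos.
Context {R : realType}.
Notation mu := (@lebesgue_measure R).

Lemma eq_integral_pos m (f g : m.-tuple R -> \bar R) :
  (forall y : m.-tuple R, {in y, forall t, 0 < t} -> f y = g y) ->
  integral_pos f = integral_pos g.
Proof.
elim: m f g => [|m ih] f g fg /=; first exact: fg.
apply: eq_integral => t; rewrite inE/= in_itv/= andbT => t0.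
apply: ih => y y0; apply: fg => s; rewrite inE => /predU1P[->//|].
exact: y0.
Qed.

Lemma integral_gamma_sum (I : finType) (h a : I -> R) :
  (forall i, 0 < a i) ->
  (\int[mu]_(t in `]0%R, +oo[) (\sum_i h i * gamma_itg (a i) t)%:E =
    (\sum_i h i * Gamma (a i))%:E)%E.
Proof.
move=> a0.
under eq_integral do rewrite -sumEFin.
have iI i : mu.-integrable `]0, +oo[ (EFin \o (fun t => h i * gamma_itg (a i) t)).
  exact/integrable_posZ/integrable_gamma_itg.
rewrite integral_sum//.
rewrite -sumEFin; apply: eq_bigr => i _.
under eq_integral do rewrite EFinM.
rewrite integralZl//; last exact: integrable_gamma_itg.
by rewrite EFin_Gamma// EFinM.
Qed.

End IntegralPos.

(** * Dyson's integration for reproducing kernels of finite rank *)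

Section Dyson.
Context {R : realType} (N : nat) (Phi : R -> 'rV[R]_N) (Psi : R -> 'cV[R]_N).
Context (C mom : 'M[R]_N).
Notation mu := (@lebesgue_measure R).

Hypothesis integral_form : forall H : 'M[R]_N,
  (\int[mu]_(t in `]0%R, +oo[) ((Phi t *m H *m Psi t) 0 0)%:E =
    (\tr (H *m mom))%:E)%E.
Hypothesis C_mom : C *m mom = 1%:M.

Definition finite_rank_kernel (x y : R) : R := (Phi x *m C *m Psi y) 0 0.

Definition det_kernel n (z : seq R) : R :=
  \det (\matrix_(i < n, j < n) finite_rank_kernel z`_i z`_j).

Definition Phi_mx n (z : seq R) : 'M[R]_(n, N) := \matrix_(i < n) Phi z`_i.
Definition Psi_mx n (z : seq R) : 'M[R]_(N, n) := \matrix_(k, j) Psi z`_j k 0.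

Lemma finite_rank_kernelE n z :
  \matrix_(i < n, j < n) finite_rank_kernel z`_i z`_j = Phi_mx n z *m C *m Psi_mx n z.
Proof.
apply/matrixP => i j; rewrite mxE /finite_rank_kernel !mxE; apply: eq_bigr => k _.
by rewrite !mxE; congr (_ * _); apply: eq_bigr => l _; rewrite !mxE.
Qed.

(** As a function of one added point, the determinant is again a quadratic form in
    [Phi t] and [Psi t], and such forms are the functions whose integrals are
    known. *)
Lemma det_kernel_rcons n z t : size z = n ->
  det_kernel n.+1 (rcons z t) =
  (Phi t *m (det_kernel n z *: C -
     C *m Psi_mx n z *m \adj (Phi_mx n z *m C *m Psi_mx n z) *m Phi_mx n z *m C)
   *m Psi t) 0 0.
Proof.
move=> sz; rewrite -addn1 /det_kernel !finite_rank_kernelE.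
set A := Phi_mx n z *m C *m Psi_mx n z.
rewrite (_ : Phi_mx (n + 1) _ *m C *m _ = block_mx A (Phi_mx n z *m C *m Psi t)
   (Phi t *m C *m Psi_mx n z) (finite_rank_kernel t t)%:M); last first.
  rewrite (_ : Phi_mx _ (rcons z t) = col_mx (Phi_mx n z) (Phi t)); last first.
    apply/matrixP => i k; rewrite !mxE; case: splitP => j ij.
      by rewrite !mxE ij nth_rcons sz ltn_ord.
    by rewrite ij nth_rcons sz ord1 addn0 ltnn eqxx.
  rewrite (_ : Psi_mx _ (rcons z t) = row_mx (Psi_mx n z) (Psi t)); last first.
    apply/matrixP => i k; rewrite !mxE; case: splitP => j ij.
      by rewrite !mxE ij nth_rcons sz ltn_ord.
    by rewrite ij nth_rcons sz ord1 addn0 ltnn eqxx.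
  rewrite mul_col_mx mul_col_row; congr (block_mx _ _ _ _).
  by apply/matrixP => i j; rewrite !ord1 [RHS]mxE eqxx.
rewrite det_bordered mulmxBr mulmxBl [RHS]mxE [X in _ = _ + X]mxE.
congr (_ - _); last by rewrite !mulmxA.
by rewrite -scalemxAr -scalemxAl [RHS]mxE mulrC.
Qed.

(** Dyson's integration step. The trace of the kernel contributes [N] times
    the determinant; by the reproducing property the border contributes the trace of
    [\adj A *m A], that is [n] times the determinant. *)
Lemma integral_det_kernel n z (c : R) : size z = n ->
  (\int[mu]_(t in `]0%R, +oo[) (c * det_kernel n.+1 (rcons z t))%:E =
    (c * ((N%:R - n%:R) * det_kernel n z))%:E)%E.
Proof.
move=> sz; set A := Phi_mx n z *m C *m Psi_mx n z.
pose H := det_kernel n z *: C - C *m Psi_mx n z *m \adj A *m Phi_mx n z *m C.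
transitivity (\int[mu]_(t in `]0%R, +oo[) ((Phi t *m (c *: H) *m Psi t) 0 0)%:E)%E.
  apply: eq_integral => t _.
  by rewrite det_kernel_rcons// -scalemxAr -scalemxAl [X in _ = X%:E]mxE.
rewrite integral_form; congr EFin.
rewrite -scalemxAl mxtraceZ; congr (_ * _).
rewrite mulmxBl -scalemxAl -!mulmxA C_mom mulmx1 mulmxA.
rewrite raddfB/= mxtraceZ mxtrace1 mxtrace_mulC.
have -> : \adj A *m Phi_mx n z *m (C *m Psi_mx n z) = (det_kernel n z)%:M.
  by rewrite /det_kernel finite_rank_kernelE -mul_adj_mx !mulmxA.
rewrite mxtrace_scalar -mulr_natr; ring.
Qed.

(** The first integration variable is outermost and is appended to the points that
    are kept, so the induction has to let [z] vary. *)
Lemma integral_pos_det_kernel m n z (c : R) : size z = n -> (n + m)%N = N ->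
  integral_pos (fun y : m.-tuple R => (c * det_kernel N (z ++ y))%:E) =
  (c * m`!%:R * det_kernel n z)%:E.
Proof.
elim: m n z c => [|m ih] n z c sz nm /=.
  by rewrite cats0 -nm addn0 fact0 mulr1.
transitivity (\int[mu]_(t in `]0%R, +oo[)
    (c * m`!%:R * det_kernel n.+1 (rcons z t))%:E)%E.
  apply: eq_integral => t _.
  under eq_fun => y do rewrite -cat_rcons.
  by apply: ih; rewrite ?size_rcons ?sz// addSnnS.
rewrite integral_det_kernel// -nm natrD factS natrM -natr1; congr EFin; ring.
Qed.

End Dyson.

(** * Correlation functions as determinants *)

Section LaguerreKernel.
Context {R : realType} (alpha theta : R).
Hypotheses (theta_gt0 : 0 < theta) (alpha_gtN1 : -1 < alpha).
Notation mu := (@lebesgue_measure R).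

Section FixedN.
Variable N : nat.

Definition lag_Phi (t : R) : 'rV[R]_N := \row_k t ^+ k.
Definition lag_Psi (t : R) : 'cV[R]_N :=
  \col_l (t `^ (theta * l%:R) * (t `^ alpha * expR (- t))).
Definition lag_coef : 'M[R]_N := \matrix_(k, l) gram_inv alpha theta N l k.
Definition lag_gram : 'M[R]_N :=
  \matrix_(l, k) Gamma (alpha + 1 + theta * l%:R + k%:R).

Lemma lag_coef_gram : lag_coef *m lag_gram = 1%:M.
Proof.
apply: mulmx1C; apply/matrixP => l' l; rewrite !mxE.
rewrite eq_sym -(gram_invP theta_gt0 alpha_gtN1 (ltn_ord l) (ltn_ord l')).
by apply: eq_bigr => k _; rewrite !mxE mulrC.
Qed.

Lemma lag_formE (H : 'M[R]_N) t : 0 < t ->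
  (lag_Phi t *m H *m lag_Psi t) 0 0 =
  \sum_(p : 'I_N * 'I_N)
    H p.1 p.2 * gamma_itg (alpha + 1 + theta * p.2%:R + p.1%:R) t.
Proof.
move=> t0; rewrite !mxE -(pair_bigA _ (fun k l =>
  H k l * gamma_itg (alpha + 1 + theta * l%:R + k%:R) t))/= exchange_big/=.
apply: eq_bigr => l _; rewrite !mxE mulr_suml; apply: eq_bigr => k _.
rewrite !mxE /gamma_itg.
have -> : alpha + 1 + theta * l%:R + k%:R - 1 = k%:R + theta * l%:R + alpha by ring.
have tD x y : t `^ (x + y) = t `^ x * t `^ y.
  by rewrite powRD// (gt_eqF t0) implybT.
by rewrite !tD powR_mulrn ?(ltW t0)//; ring.
Qed.

Lemma lag_integral_form (H : 'M[R]_N) :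
  (\int[mu]_(t in `]0%R, +oo[) ((lag_Phi t *m H *m lag_Psi t) 0 0)%:E =
    (\tr (H *m lag_gram))%:E)%E.
Proof.
transitivity (\int[mu]_(t in `]0%R, +oo[) (\sum_(p : 'I_N * 'I_N)
    H p.1 p.2 * gamma_itg (alpha + 1 + theta * p.2%:R + p.1%:R) t)%:E)%E.
  by apply: eq_integral => t; rewrite inE/= in_itv/= andbT => t0; rewrite lag_formE.
rewrite integral_gamma_sum; last first.
  by move=> p; rewrite ltr_wpDr// moment_arg_gt0.
congr EFin; rewrite -(pair_bigA _ (fun k l : 'I_N =>
  H k l * Gamma (alpha + 1 + theta * l%:R + k%:R)))/=.
by apply: eq_bigr => k _; rewrite !mxE; apply: eq_bigr => l _; rewrite !mxE.
Qed.

Definition lag_kernel := finite_rank_kernel lag_Phi lag_Psi lag_coef.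

Lemma det_lag_coef_neq0 : \det lag_coef != 0.
Proof.
have := congr1 determinant lag_coef_gram; rewrite det_mulmx det1 => h.
by apply/eqP => c0; move: h; rewrite c0 mul0r => /eqP; rewrite eq_sym oner_eq0.
Qed.

(** Both Vandermonde products change sign together when the order of the differences
    is reversed. *)
Lemma laguerre_weightE (x : N.-tuple R) : {in x, forall t, 0 < t} ->
  laguerre_weight alpha theta x =
  (\det lag_coef)^-1 * det_kernel lag_Phi lag_Psi lag_coef N x.
Proof.
move=> x0; rewrite /det_kernel finite_rank_kernelE !det_mulmx.
have x0i (i : 'I_N) : 0 < tnth x i by apply: x0; exact: mem_tnth.
have -> : Phi_mx lag_Phi N x = (Vandermonde N (\row_i tnth x i))^T.
  by apply/matrixP => i k; rewrite !mxE (tnth_nth 0).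
have -> : Psi_mx lag_Psi N x = Vandermonde N (\row_i (tnth x i `^ theta)) *m
    diag_mx (\row_i (tnth x i `^ alpha * expR (- tnth x i))).
  apply/matrixP => l j; rewrite mul_mx_diag !mxE -(tnth_nth 0); congr (_ * _).
  by rewrite -powR_mulrn ?powR_ge0// -powRrM.
rewrite det_mulmx det_diag det_tr !det_Vandermonde.
rewrite [RHS](_ : _ = (\prod_(i < N) \prod_(j < N | (i < j)%N)
    ((tnth x j - tnth x i) * (tnth x j `^ theta - tnth x i `^ theta))) *
   \prod_(i < N) (tnth x i `^ alpha * expR (- tnth x i))).
  rewrite /laguerre_weight -mulrA; congr (_ * _).
    by apply: eq_bigr => i _; apply: eq_bigr => j _; rewrite -mulrNN !opprB.
  by rewrite -sumrN expR_sum -big_split.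
under [in RHS]eq_bigr do rewrite big_split/=.
rewrite big_split/=.
set a := \prod_(i < N) _; set b := \prod_(i < N) _; set w := \prod_(i < N) _.
have -> : \prod_(i < N) \prod_(j < N | (i < j)%N) (tnth x j - tnth x i) = a.
  by apply: eq_bigr => i _; apply: eq_bigr => j _; rewrite !mxE.
have -> : \prod_(i < N) \prod_(j < N | (i < j)%N)
    (tnth x j `^ theta - tnth x i `^ theta) = b.
  by apply: eq_bigr => i _; apply: eq_bigr => j _; rewrite !mxE.
have -> : \prod_(i < N) (tnth x i `^ alpha * expR (- tnth x i)) = w.
  by apply: eq_bigr => i _; rewrite !mxE.
by field; exact: det_lag_coef_neq0.
Qed.

Lemma laguerre_partitionE :
  laguerre_partition alpha theta N = (\det lag_coef)^-1 * N`!%:R.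
Proof.
rewrite /laguerre_partition (eq_integral_pos (g := fun x : N.-tuple R =>
  ((\det lag_coef)^-1 * det_kernel lag_Phi lag_Psi lag_coef N ([::] ++ x))%:E)).
  rewrite (integral_pos_det_kernel lag_integral_form lag_coef_gram (n := 0))//.
  by rewrite /det_kernel det_mx00 mulr1.
by move=> x x0; rewrite laguerre_weightE.
Qed.

(** The same constant appears in the normalization and in the integral over the
    remaining variables, which differ only in the number of points kept. *)
Lemma laguerre_corrE n (x : n.-tuple R) : (n <= N)%N ->
  (forall i, 0 < tnth x i) ->
  laguerre_corr alpha theta N x =
  \det (\matrix_(i < n, j < n) lag_kernel (tnth x i) (tnth x j)).
Proof.
move=> nN x0; rewrite /laguerre_corr.
pose c := (laguerre_partition alpha theta N)^-1 * (\det lag_coef)^-1.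
rewrite (eq_integral_pos (g := fun y : (N - n).-tuple R =>
  (c * det_kernel lag_Phi lag_Psi lag_coef N (x ++ y))%:E)); last first.
  move=> y y0; congr EFin; rewrite /laguerre_density laguerre_weightE.
    rewrite mulrA; congr (_ * \det _); apply/matrixP => i j; rewrite !mxE.
    by rewrite -!(tnth_nth 0) !tnth_mktuple.
  move=> t /tnthP[i ->]; rewrite tnth_mktuple.
  have : (x ++ y)`_i \in x ++ y.
    by apply: mem_nth; rewrite size_cat !size_tuple subnKC.
  by rewrite mem_cat => /orP[/tnthP[j ->]|]; [exact: x0|exact: y0].
rewrite (integral_pos_det_kernel lag_integral_form lag_coef_gram c
  (size_tuple x) (subnKC nN)).
rewrite /= /c laguerre_partitionE.
rewrite (_ : det_kernel _ _ _ n x =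
  \det (\matrix_(i < n, j < n) lag_kernel (tnth x i) (tnth x j))); last first.
  congr (\det _); apply/matrixP => i j; rewrite !mxE.
  by rewrite -!(tnth_nth 0).
by field; rewrite !natf_neq0 det_lag_coef_neq0.
Qed.

End FixedN.
End LaguerreKernel.

(** * Limits of sums, determinants and Gamma ratios *)

Section Limits.
Context {R : realType}.

(** Dominated convergence for series, with a range of summation that grows with
    [N]. *)
Lemma tannery (f : nat -> nat -> R) (g h : nat -> R) :
  (forall N l, (l < N)%N -> `|f N l| <= g l) ->
  (forall l, f N l @[N --> \oo] --> h l) -> cvgn (series g) ->
  \sum_(l < N) f N l @[N --> \oo] --> limn (series h).
Proof.
move=> fg fh cg.
have hg l : `|h l| <= g l.
  have cn : `|f N l| @[N --> \oo] --> `|h l| by apply: cvg_norm; exact: fh.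
  rewrite -(cvg_lim _ cn)//; apply: limr_le; first by apply/cvg_ex; exists `|h l|.
  by near=> N; apply: fg; near: N; exact: nbhs_infty_gt.
have g0 l : 0 <= g l by apply: le_trans (hg l).
have ch : cvgn (series h).
  apply: normed_cvg; apply: series_le_cvg cg => //= l; exact: hg.
have nd : {homo series g : n m / (n <= m)%N >-> n <= m}.
  by move=> n m nm; apply: nondecreasing_series => //.
(* One quarter each for the tails of [f N] and of [h] beyond [M], for the partial
   sums up to [M], and for the remainder of [h] beyond [N]. *)
apply/cvgrPdist_lt => e e0; have e4 : 0 < e / 4 by rewrite divr_gt0.
have [M _ gM] := (cvgrPdist_lt _ _).1 cg _ e4.
have {gM} tail n : (M <= n)%N -> \sum_(M <= l < n) g l < e / 4.
  move=> Mn; rewrite -sub_series_geq//.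
  have := gM M (leqnn M); have := nondecreasing_cvgn_le nd cg n.
  move=> h1 /= /ltr_normlP[_ h2]; lra.
have cM : \sum_(l < M) f N l @[N --> \oo] --> \sum_(l < M) h l.
  by apply: cvg_big => //; exact: add_continuous.
near=> N.
have MN : (M <= N)%N by near: N; exact: nbhs_infty_ge.
have h1 : `|limn (series h) - series h N| < e / 4.
  by near: N; exact: (cvgrPdist_lt _ _).1 ch _ e4.
have h2 : `|\sum_(l < M) h l - \sum_(l < M) f N l| < e / 4.
  by near: N; exact: (cvgrPdist_lt _ _).1 cM _ e4.
have split_sum (u : nat -> R) :
    \sum_(l < N) u l = \sum_(l < M) u l + \sum_(M <= l < N) u l.
  by rewrite -!(big_mkord xpredT u) -big_cat_nat.
have h3 : `|\sum_(M <= l < N) f N l| <= \sum_(M <= l < N) g l.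
  apply: le_trans (ler_norm_sum _ _ _) _.
  by rewrite !big_nat; apply: ler_sum => l /andP[_ lN]; exact: fg.
have h4 : `|\sum_(M <= l < N) h l| <= \sum_(M <= l < N) g l.
  by apply: le_trans (ler_norm_sum _ _ _) _; apply: ler_sum.
have t := tail N MN.
rewrite split_sum.
have e1 : series h N = \sum_(l < M) h l + \sum_(M <= l < N) h l.
  by rewrite -split_sum /series/= big_mkord.
rewrite e1 in h1.
move: h1 h2 h3 h4 t.
move: (limn _) (\sum_(l < M) h l) (\sum_(l < M) f N l) (\sum_(M <= l < N) h l)
  (\sum_(M <= l < N) f N l) (\sum_(M <= l < N) g l) => a b c d p q.
rewrite !ltr_norml !ler_norml => /andP[? ?] /andP[? ?] /andP[? ?] /andP[? ?] ?.
by apply/andP; split; lra.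
Unshelve. all: end_near. Qed.

Lemma cvg_det n (A : nat -> 'M[R]_n) (B : 'M[R]_n) :
  (forall i j, A N i j @[N --> \oo] --> B i j) ->
  \det (A N) @[N --> \oo] --> \det B.
Proof.
move=> AB; apply: cvg_big => [|s _]; first exact: add_continuous.
apply: cvgM; first exact: cvg_cst.
by apply: cvg_big => [|i _]; [exact: mul_continuous|exact: AB].
Qed.

Lemma cvg_invn : N%:R^-1 @[N --> \oo] --> (0 : R).
Proof. by rewrite -cvg_shiftS; exact: cvg_harmonic. Qed.

Lemma cvg_powRNn (c : R) : 0 < c -> N%:R `^ (- c) @[N --> \oo] --> (0 : R).
Proof.
move=> c0; rewrite -cvg_shiftS.
rewrite (_ : [sequence _]_n = fun n => (n.+1%:R^-1 : R) `^ c).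
  have := (cvg_at_rightP (@powR R ^~ c) 0 0).1 (powR_cvg0 c0); apply; split.
    by move=> n; rewrite invr_gt0.
  exact: cvg_harmonic.
by apply/funext => n /=; rewrite -powR_inv1// -powRrM mulN1r.
Qed.

Lemma cvg_1Dinvn (c : R) : 1 + c / N%:R @[N --> \oo] --> (1 : R).
Proof.
rewrite -[X in _ --> X]addr0; apply: cvgD; first exact: cvg_cst.
by rewrite -(mulr0 c); apply: cvgM; [exact: cvg_cst|exact: cvg_invn].
Qed.

Lemma Gamma_nat n : Gamma (n.+1%:R) = n`!%:R :> R.
Proof.
elim: n => [|n ih]; first by rewrite Gamma1.
by rewrite -[n.+2%:R]natr1 GammaS// ih factS natrM.
Qed.

Definition gamma_ratio (a : R) N := Gamma (N%:R + a) / (N.-1`!%:R * N%:R `^ a).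

Definition falling_ratio l N : R := N.-1`!%:R / ((N - l.+1)`!%:R * N%:R ^+ l).

(** The upper bound is [le_Gamma_shift] at [N]; the lower bound is the same
    inequality applied to the step from [N + f] to [N + 1]. *)
Lemma gamma_ratio_bounds f N : 0 <= f <= 1 -> (0 < N)%N ->
  (1 + f / N%:R)^-1 <= gamma_ratio f N <= 1.
Proof.
case: N => // N /andP[f0 f1] _; rewrite /gamma_ratio/=.
have n0 : 0 < N.+1%:R :> R by [].
have p0 : 0 < N.+1%:R `^ f :> R by rewrite powR_gt0.
have nf : 0 < N.+1%:R + f by rewrite ltr_wpDr.
have d0 : 0 < N`!%:R * N.+1%:R `^ f :> R by rewrite mulr_gt0// ltr0n fact_gt0.
apply/andP; split; last first.
  rewrite ler_pdivrMr// mul1r mulrC -Gamma_nat; apply: le_Gamma_shift => //.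
  by rewrite f0.
rewrite ler_pdivlMr// -[leLHS]mulrC.
have -> : (1 + f / N.+1%:R)^-1 = N.+1%:R / (N.+1%:R + f).
  have aux (u : R) : 0 < u -> 0 < u + f -> (1 + f / u)^-1 = u / (u + f).
    by move=> u0 uf; field; rewrite !gt_eqF//.
  exact: aux.
rewrite mulrA ler_pdivrMr//.
have h : N.+1%:R * N`!%:R <= (N.+1%:R + f) `^ (1 - f) * Gamma (N.+1%:R + f).
  rewrite -natrM -factS -Gamma_nat -[n in Gamma n]natr1.
  rewrite (_ : N.+1%:R + 1 = N.+1%:R + f + (1 - f)); last by ring.
  by apply: le_Gamma_shift => //; rewrite subr_ge0 f1 gerBl.
have h2 : N.+1%:R `^ f <= (N.+1%:R + f) `^ f.
  by rewrite ge0_ler_powR ?nnegrE// ?(ltW nf)// lerDl.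
have e : (N.+1%:R + f) `^ (1 - f) * (N.+1%:R + f) `^ f = N.+1%:R + f.
  rewrite -powRD; first by rewrite subrK powRr1// ltW.
  by rewrite (gt_eqF nf) implybT.
rewrite -[X in _ <= _ * X]e mulrA [leLHS]mulrAC ler_pM//.
by rewrite mulrC [leRHS]mulrC.
Qed.

(** For [a] in [0, 1] the bounds above squeeze the ratio, and raising [a] by 1
    multiplies it by [1 + a / N]. *)
Lemma cvg_gamma_ratio a : 0 <= a -> gamma_ratio a N @[N --> \oo] --> (1 : R).
Proof.
move=> a0; have [m] : exists m : nat, a <= m.+1%:R.
  by exists (Num.truncn a); exact/ltW/truncnS_gt.
elim: m a a0 => [|m ih] a a0 am.
  apply: (squeeze_cvgr (f := fun N => (1 + a / N%:R)^-1) (h := fun=> 1)).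
  - near=> N; apply: gamma_ratio_bounds; first by rewrite a0.
    by near: N; exact: nbhs_infty_gt.
  - by rewrite -[X in _ --> X]invr1; apply: cvgV; [rewrite oner_eq0|exact: cvg_1Dinvn].
  - exact: cvg_cst.
have [a1|a1] := leP a 1; first by apply: ih => //; rewrite (le_trans a1)// ler1n.
have b0 : 0 <= a - 1 by lra.
have bm : a - 1 <= m.+1%:R by move: am; rewrite -[m.+2%:R]natr1; lra.
have h : gamma_ratio (a - 1) N * (1 + (a - 1) / N%:R) @[N --> \oo] --> (1 : R).
  rewrite -[X in _ --> X]mulr1; apply: cvgM; first exact: ih.
  exact: cvg_1Dinvn.
apply: cvg_trans h; apply: near_eq_cvg; near=> N.
have N0 : 0 < N%:R :> R by rewrite ltr0n; near: N; exact: nbhs_infty_gt.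
rewrite /gamma_ratio.
rewrite [RHS](_ : _ = Gamma (N%:R + (a - 1) + 1) / (N.-1`!%:R * N%:R `^ a)); last first.
  by congr (Gamma _ / _); ring.
rewrite GammaS; last by rewrite ltr_wpDr.
have -> : N%:R `^ a = N%:R * N%:R `^ (a - 1).
  by rewrite mulr_powRB1 ?(ltW N0)//; lra.
by field; rewrite natf_neq0 !gt_eqF// powR_gt0.
Unshelve. all: end_near. Qed.

Lemma cvg_falling_ratio l : falling_ratio l N @[N --> \oo] --> (1 : R).
Proof.
elim: l => [|l ih].
  have h : (fun=> 1) x @[x --> \oo] --> (1 : R) by exact: cvg_cst.
  apply: cvg_trans h; apply: near_eq_cvg; near=> N.
  by rewrite /falling_ratio expr0 mulr1 subn1 divff// natf_neq0.
have h : falling_ratio l N * (1 + (- l.+1%:R) / N%:R) @[N --> \oo] --> (1 : R).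
  rewrite -[X in _ --> X]mulr1; apply: cvgM; first exact: ih.
  exact: cvg_1Dinvn.
apply: cvg_trans h; apply: near_eq_cvg; near=> N.
have lN : (l.+1 < N)%N by near: N; exact: nbhs_infty_gt.
have N0 : N%:R != 0 :> R by rewrite pnatr_eq0 -lt0n (leq_trans _ lN).
rewrite /falling_ratio.
have -> : (N - l.+1)`!%:R = (N%:R - l.+1%:R) * (N - l.+2)`!%:R :> R.
  by rewrite -(subnSK lN) factS natrM subnSK// natrB// ltnW.
have d0 : N%:R - l.+1%:R != 0 :> R by rewrite subr_eq0 eqr_nat gtn_eqF.
have aux (x y u v w : R) : x != 0 -> y != 0 -> x - y != 0 -> u != 0 -> v != 0 ->
    w / ((x - y) * u * v) * (1 + - y / x) = w / (u * (x * v)).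
  by move=> x0 y0 xy u0 v0; field; rewrite x0 xy u0 v0.
by rewrite exprS aux// ?natf_neq0// expf_neq0.
Unshelve. all: end_near. Qed.

Lemma falling_ratio_le1 l N : (l < N)%N -> falling_ratio l N <= 1.
Proof.
case: N => // N lN; rewrite /falling_ratio subSS ler_pdivrMr ?mul1r/=; last first.
  by rewrite mulr_gt0 ?exprn_gt0 ?ltr0n ?fact_gt0.
rewrite -natrX -natrM ler_nat -(ffact_fact (_ : l <= N)%N)// mulnC leq_mul2l.
apply/orP; right; elim: l lN => // l ih lN.
by rewrite ffactnSr expnSr leq_mul ?ih//; lia.
Qed.

(** Each factor is at most [expR (a / j)], and the harmonic sums are bounded by
    [1 + ln M]; since [ln 0 = 0] the bound also covers the empty product. *)
Lemma prod_1D_le (a : R) M : 0 <= a ->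
  \prod_(j < M) (1 + a / j.+1%:R) <= expR (a * (1 + ln M%:R)).
Proof.
move=> a0; elim: M => [|M ih].
  rewrite big_ord0 -expR0 ler_expR mulr_ge0// ler_wpDr// ln0//.
rewrite big_ord_recr/=.
have M0 : 0 < M.+1%:R :> R by [].
have h1 : 1 + a / M.+1%:R <= expR (a / M.+1%:R) by exact: expR_ge1Dx.
have h0 : 0 <= 1 + a / M.+1%:R by rewrite addr_ge0// divr_ge0.
case: M ih M0 h1 h0 => [|M] ih M0 h1 h0.
  by rewrite big_ord0 mul1r ln1 addr0 mulr1; rewrite divr1 in h1 *.
apply: le_trans (ler_pM _ h0 ih h1) _.
  by apply: prodr_ge0 => j _; rewrite addr_ge0// divr_ge0.
rewrite -expRD ler_expR -mulrDr ler_wpM2l// -addrA lerD2l.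
have e : ln M.+1%:R = ln M.+2%:R + ln (1 + - M.+2%:R^-1) :> R.
  rewrite -lnM ?posrE//; last first.
    by rewrite subr_gt0 invf_lt1// ltr1n.
  by congr ln; rewrite mulrDr mulr1 mulrN divff// -[M.+2%:R]natr1 addrK.
have := @le_ln1Dx R (- M.+2%:R^-1); rewrite ltrN2 invf_lt1// ltr1n => /(_ isT).
by rewrite e => h; rewrite -addrA gerDl -lerBrDr sub0r.
Qed.

End Limits.

(** * Convergence of the rescaled coefficients *)

Section HardEdge.
Context {R : realType} (alpha theta : R).
Hypotheses (theta_gt0 : 0 < theta) (alpha_gtN1 : -1 < alpha).

(** The N-dependent part of [altdiff k (nodal_poly N l)], normalized so as to have a
    limit. *)
Definition nodal_ratio (a : R) l N : R :=
  (\prod_(j < N | j != l :> nat) (a + j%:R)) / (N.-1`!%:R * N%:R `^ a).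

Lemma risingD1 (a : R) l N : (l < N)%N ->
  rising a N = (a + l%:R) * \prod_(j < N | j != l :> nat) (a + j%:R).
Proof. by move=> lN; rewrite /rising (bigD1 (Ordinal lN)). Qed.

Lemma cvg_nodal_ratio (a : R) l : 0 < a ->
  nodal_ratio a l N @[N --> \oo] --> (Gamma a * (a + l%:R))^-1.
Proof.
move=> a0; have G0 := Gamma_gt0 a0.
have al : 0 < a + l%:R by rewrite ltr_wpDr.
have h : gamma_ratio a N / (Gamma a * (a + l%:R)) @[N --> \oo]
    --> (Gamma a * (a + l%:R))^-1.
  rewrite -[X in _ --> X]mul1r; apply: cvgM; last exact: cvg_cst.
  exact/cvg_gamma_ratio/ltW.
apply: cvg_trans h; apply: near_eq_cvg; near=> N.
have lN : (l < N)%N by near: N; exact: nbhs_infty_gt.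
rewrite /gamma_ratio addrC Gamma_rising// (risingD1 _ lN) /nodal_ratio.
field; rewrite natf_neq0 (gt_eqF G0) (gt_eqF al) gt_eqF//.
by rewrite powR_gt0// ltr0n (leq_trans _ lN).
Unshelve. all: end_near. Qed.

Lemma nodal_ratio_ge0 (a : R) l N : 0 < a -> 0 <= nodal_ratio a l N.
Proof.
move=> a0; rewrite divr_ge0 ?mulr_ge0 ?powR_ge0//.
by apply: prodr_ge0 => j _; rewrite addr_ge0 ?(ltW a0).
Qed.

(** Dropping the factor [a + l] instead of the factor [a] from the rising factorial
    can only decrease the product, and what remains is [(N - 1)!] times the
    product bounded by [prod_1D_le]. *)
Lemma nodal_ratio_le (a : R) l N : 0 < a -> (l < N)%N ->
  nodal_ratio a l N <= expR a.
Proof.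
move=> a0 lN; case: N lN => // N lN.
have d0 : 0 < N`!%:R * N.+1%:R `^ a :> R.
  by rewrite mulr_gt0 ?powR_gt0// ltr0n fact_gt0.
rewrite ler_pdivrMr//.
have p0 : 0 <= \prod_(j < N.+1 | j != l :> nat) (a + j%:R).
  by apply: prodr_ge0 => j _; rewrite addr_ge0 ?(ltW a0).
have e : rising a N.+1 = a * (N`!%:R * \prod_(j < N) (1 + a / j.+1%:R)).
  rewrite /rising big_ord_recl addr0 natr_fact -big_split/=; congr (_ * _).
  by apply: eq_bigr => j _; rewrite mulrDr mulr1 mulrC divfK// addrC.
have h1 : \prod_(j < N.+1 | j != l :> nat) (a + j%:R) <=
    N`!%:R * \prod_(j < N) (1 + a / j.+1%:R).
  rewrite -(ler_pM2l a0) -e (risingD1 _ lN) ler_wpM2r// lerDl//.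
apply: le_trans h1 _; rewrite mulrCA ler_wpM2l//.
apply: le_trans (prod_1D_le N (ltW a0)) _.
rewrite /powR pnatr_eq0/= -expRD ler_expR mulrDr mulr1 lerD2l ler_wpM2l ?(ltW a0)//.
case: N {lN d0 p0 e} => [|N]; first by rewrite ln0// ln_ge0// ler1n.
by rewrite ler_ln ?posrE// ler_nat.
Qed.

Lemma node_gt0 k : 0 < node alpha theta k.
Proof.
by rewrite divr_gt0// ltr_wpDl//; have := alpha_gtN1; lra.
Qed.

Variables x y : R.
Hypotheses (x_gt0 : 0 < x) (y_gt0 : 0 < y).

(** The (k, l) term of the kernel for [N] points at the rescaled arguments; the
    leading power of [N] collects the factor [N `^ (- theta^-1)] per variable and
    the factor [t `^ alpha] of the weight. *)
Definition scaled_term N k l : R :=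
  N%:R `^ (- ((alpha + 1) / theta)) * (x / N%:R `^ (1 / theta)) ^+ k *
  gram_inv alpha theta N l k * (y / N%:R `^ (1 / theta)) `^ (theta * l%:R).

Definition prefactor k l : R :=
  x ^+ k * y `^ (theta * l%:R) / (k`!%:R * l`!%:R * moment alpha theta l).

Lemma moment_gt0 l : 0 < moment alpha theta l.
Proof. by apply: Gamma_gt0; exact: moment_arg_gt0. Qed.

Lemma scaled_termE N k l : (l < N)%N ->
  scaled_term N k l = (-1) ^+ l * prefactor k l *
    \sum_(m < k.+1) (-1) ^+ m * 'C(k, m)%:R *
      (N%:R `^ (node alpha theta m - node alpha theta k) *
       falling_ratio l N * nodal_ratio (node alpha theta m) l N).
Proof.
move=> lN; have N0 : 0 < N%:R :> R by rewrite ltr0n (leq_trans _ lN).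
have pD u v : N%:R `^ (u + v) = N%:R `^ u * N%:R `^ v :> R.
  by rewrite powRD// (gt_eqF N0) implybT.
have pp u : 0 < N%:R `^ u :> R by rewrite powR_gt0.
have pow_k : (N%:R `^ (1 / theta)) ^+ k = N%:R `^ (k%:R / theta) :> R.
  by rewrite -powR_mulrn ?powR_ge0// -powRrM mulrC mulrA mulr1.
have pow_l : (N%:R `^ (1 / theta)) `^ (theta * l%:R) = N%:R ^+ l :> R.
  rewrite -powRrM -powR_mulrn ?ltW//; congr (_ `^ _).
  by field; rewrite gt_eqF.
rewrite /scaled_term expr_div_n pow_k.
have -> : (y / N%:R `^ (1 / theta)) `^ (theta * l%:R) =
    y `^ (theta * l%:R) / N%:R ^+ l.
  rewrite powRM ?invr_ge0 ?powR_ge0 ?(ltW y_gt0)// -pow_l; congr (_ * _).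
  by rewrite -powR_inv1 ?powR_ge0// -powRrM mulN1r powRN.
rewrite /gram_inv /altdiff !mulr_sumr !mulr_suml.
apply: eq_bigr => m _; rewrite horner_nodal -/(node _ _ _).
rewrite /nodal_ratio /falling_ratio /prefactor pD.
have -> : N%:R `^ (- node alpha theta k) =
    N%:R `^ (- ((alpha + 1) / theta)) / N%:R `^ (k%:R / theta) :> R.
  by rewrite -powRN -pD; congr (_ `^ _); rewrite /node; field; rewrite gt_eqF.
move: (\prod_(j < N | _) _) => P.
have mz := moment_gt0 l.
by field; rewrite !natf_neq0 ?(gt_eqF mz) ?(gt_eqF (pp _)) expf_neq0// gt_eqF.
Qed.

Lemma nodeB m k : node alpha theta m - node alpha theta k = (m%:R - k%:R) / theta.
Proof. by rewrite /node; field; rewrite gt_eqF. Qed.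

(** Only [m = k] contributes, since the other terms carry a negative power of
    [N]. *)
Lemma cvg_scaled_term k l :
  scaled_term N k l @[N --> \oo] --> kernel_term alpha theta x y k l.
Proof.
have a0 m := node_gt0 m.
pose h m : R := (-1) ^+ m * 'C(k, m)%:R *
  ((m == k)%:R * 1 * (Gamma (node alpha theta m) * (node alpha theta m + l%:R))^-1).
have kE : kernel_term alpha theta x y k l =
    (-1) ^+ l * prefactor k l * \sum_(m < k.+1) h m.
  rewrite big_ord_recr/= big1 ?add0r; last first.
    by move=> m _; rewrite /h ltn_eqF// !mul0r mulr0.
  rewrite /h eqxx binn /kernel_term /prefactor /moment.
  have -> : (alpha + 1 + k%:R) / theta = node alpha theta k.
    by rewrite /node addrC.
  have -> : theta / (alpha + 1 + k%:R + theta * l%:R) = (node alpha theta k + l%:R)^-1.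
    have p : alpha + 1 + k%:R + theta * l%:R != 0.
      by rewrite gt_eqF// addrAC ltr_wpDr// moment_arg_gt0.
    rewrite /node [k%:R + _]addrC; move: (alpha + 1 + k%:R) (l%:R) p => u w p.
    by rewrite -[RHS]div1r; field; rewrite (gt_eqF theta_gt0)/= mulrC.
  have G1 := Gamma_gt0 (a0 k).
  have G2 := moment_gt0 l; rewrite /moment in G2.
  have n1 : 0 < node alpha theta k + l%:R by rewrite ltr_wpDr.
  have -> : true%:R = 1 :> R by [].
  by field; rewrite !natf_neq0 !gt_eqF.
rewrite kE.
have cs : (-1) ^+ l * prefactor k l * \sum_(m < k.+1) ((-1) ^+ m * 'C(k, m)%:R *
      (N%:R `^ (node alpha theta m - node alpha theta k) *
       falling_ratio l N * nodal_ratio (node alpha theta m) l N)) @[N --> \oo]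
    --> (-1) ^+ l * prefactor k l * \sum_(m < k.+1) h m.
  apply: cvgM; first exact: cvg_cst.
  apply: cvg_big => [|m _]; first exact: add_continuous.
  apply: cvgM; first exact: cvg_cst.
  apply: cvgM; last exact: cvg_nodal_ratio.
  apply: cvgM; last exact: cvg_falling_ratio.
  rewrite nodeB; have [->|mk] := eqVneq (val m) k.
    rewrite subrr mul0r; under eq_fun do rewrite powRr0.
    exact: cvg_cst.
  have mk' : (m < k)%N by rewrite ltn_neqAle mk -ltnS ltn_ord.
  rewrite -opprB mulNr; apply: cvg_powRNn.
  by rewrite divr_gt0// subr_gt0 ltr_nat.
apply: cvg_trans cs; apply: near_eq_cvg; near=> N.
by rewrite scaled_termE//; near: N; exact: nbhs_infty_gt.
Unshelve. all: end_near. Qed.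

(** The domination of the summand of index (k, l): the binomial sum over [m] costs
    [2 ^+ k], and the node [k] contributes [expR (node k)], which is geometric in
    [k]. *)
Definition row_bound k : R :=
  expR (node alpha theta 0) * exp_coeff (2 * x * expR (theta^-1)) k.

Definition col_bound l : R :=
  2 * (alpha + 1 + theta) * exp_coeff (2 * y `^ theta) l.

(** The factor [2 ^+ l] absorbs the linear growth in [l]. *)
Lemma moment_inv_le l :
  (moment alpha theta l)^-1 <= 2 * (alpha + 1 + theta) * 2 ^+ l.
Proof.
have c0 := moment_arg_gt0 theta_gt0 alpha_gtN1 l; set c := _ + _ in c0.
have := Gamma_ge_half (ltW c0); rewrite GammaS// -/(moment alpha theta l) => h.
have m0 := moment_gt0 l.
have p2 : (l%:R <= 2 ^+ l :> R) && (1 <= 2 ^+ l :> R).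
  by rewrite -natrX ler_nat ler1n expn_gt0 andbT ltnW// ltn_expl.
have {p2} /andP[p2 p1] := p2.
have cle : c <= (alpha + 1 + theta) * 2 ^+ l.
  rewrite mulrDl lerD//; last by rewrite ler_wpM2l// ltW.
  by rewrite ler_peMr//; have := alpha_gtN1; lra.
rewrite -(ler_pM2r m0) mulVf ?gt_eqF//.
have : 1 <= 2 * (c * moment alpha theta l) by move: h; rewrite /moment -/c; lra.
move=> /le_trans; apply; rewrite -!mulrA ler_pM2l// !mulrA ler_pM2r//.
Qed.

Lemma scaled_term_le N k l : (l < N)%N ->
  `|scaled_term N k l| <= row_bound k * col_bound l.
Proof.
move=> lN; have a0 m := node_gt0 m.
have N1 : 1 <= N%:R :> R by rewrite ler1n (leq_trans _ lN).
have pf0 : 0 <= prefactor k l.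
  by rewrite divr_ge0 ?mulr_ge0 ?exprn_ge0 ?powR_ge0 ?(ltW x_gt0)// ltW// moment_gt0.
rewrite scaled_termE// 2!normrM normrX normrN1 expr1n mul1r (ger0_norm pf0).
have sum_le : `|\sum_(m < k.+1) (-1) ^+ m * 'C(k, m)%:R *
      (N%:R `^ (node alpha theta m - node alpha theta k) *
       falling_ratio l N * nodal_ratio (node alpha theta m) l N)| <=
    2 ^+ k * expR (node alpha theta k).
  have -> : 2 ^+ k = \sum_(m < k.+1) 'C(k, m)%:R :> R.
    rewrite -[2]/(1 + 1) exprDn; apply: eq_bigr => m _.
    by rewrite !expr1n mulr1.
  rewrite mulr_suml; apply: le_trans (ler_norm_sum _ _ _) _.
  apply: ler_sum => m _; rewrite 4!normrM normrX normrN1 expr1n mul1r normr_nat.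
  rewrite ler_wpM2l//.
  have f0 : 0 <= falling_ratio l N :> R.
    by rewrite /falling_ratio divr_ge0 ?mulr_ge0 ?exprn_ge0.
  have f1 : falling_ratio l N <= 1 :> R by exact: falling_ratio_le1.
  have v0 := nodal_ratio_ge0 l N (a0 m); have v1 := nodal_ratio_le (a0 m) lN.
  move: (falling_ratio l N) (nodal_ratio _ l N) f0 f1 v0 v1 => f v f0 f1 v0 v1.
  have p0 : 0 <= N%:R `^ ((m%:R - k%:R) / theta) :> R by exact: powR_ge0.
  have mk : (m%:R - k%:R) / theta <= 0.
    by rewrite mulr_le0_ge0 ?invr_ge0 ?(ltW theta_gt0)// subr_le0 ler_nat -ltnS.
  have p1 : N%:R `^ ((m%:R - k%:R) / theta) <= 1 :> R.
    by rewrite -[leRHS](powRr0 N%:R) ler_powR.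
  have vk : v <= expR (node alpha theta k).
    by apply: le_trans v1 _; rewrite ler_expR -subr_le0 nodeB.
  rewrite nodeB !ger0_norm// -[leRHS]mul1r ler_pM ?mulr_ge0//.
  by rewrite -[leRHS]mul1r ler_pM.
apply: le_trans (ler_wpM2l pf0 sum_le) _.
rewrite /prefactor /row_bound /col_bound /exp_coeff.
have -> : node alpha theta k = node alpha theta 0 + k%:R * theta^-1.
  by rewrite /node; field; rewrite gt_eqF.
rewrite /= expRD expRM_natl !exprMn.
have -> : y `^ (theta * l%:R) = (y `^ theta) ^+ l.
  by rewrite powRrM powR_mulrn// powR_ge0.
have yl0 : 0 <= (y `^ theta) ^+ l by rewrite exprn_ge0// powR_ge0.
pose q := x ^+ k / k`!%:R *
   (2 ^+ k * (expR (node alpha theta 0) * expR theta^-1 ^+ k)) *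
   ((y `^ theta) ^+ l / l`!%:R).
have q0 : 0 <= q.
  by rewrite /q !mulr_ge0 ?invr_ge0 ?exprn_ge0 ?expR_ge0 ?(ltW x_gt0)// powR_ge0.
have := ler_wpM2l q0 (moment_inv_le l).
have m0 := moment_gt0 l.
congr (_ <= _); rewrite /q; field; rewrite ?natf_neq0 ?gt_eqF//.
Qed.

Lemma is_cvg_row_bound : cvgn (series row_bound).
Proof. exact/is_cvg_seriesZ/is_cvg_series_exp_coeff. Qed.

Lemma is_cvg_col_bound : cvgn (series col_bound).
Proof. exact/is_cvg_seriesZ/is_cvg_series_exp_coeff. Qed.

Lemma col_bound_ge0 l : 0 <= col_bound l.
Proof.
rewrite /col_bound mulr_ge0//; last exact/exp_coeff_ge0/mulr_ge0/powR_ge0.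
by have := alpha_gtN1; have := theta_gt0; lra.
Qed.

Lemma row_bound_ge0 k : 0 <= row_bound k.
Proof.
rewrite /row_bound mulr_ge0 ?expR_ge0// exp_coeff_ge0//.
by rewrite !mulr_ge0 ?expR_ge0// ltW.
Qed.

(** Tannery's theorem for the inner sums over [l], then for the sum over [k]. *)
Lemma cvg_scaled_sum :
  \sum_(k < N) \sum_(l < N) scaled_term N k l @[N --> \oo]
    --> laguerre_kernel alpha theta x y.
Proof.
pose B := limn (series col_bound).
apply: (@tannery R (fun N k => \sum_(l < N) scaled_term N k l)
  (fun k => row_bound k * B)).
- move=> N k _; apply: le_trans (ler_norm_sum _ _ _) _.
  apply: (@le_trans _ _ (row_bound k * series col_bound N)).
    rewrite /series/= big_mkord mulr_sumr; apply: ler_sum => l _.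
    exact: scaled_term_le.
  rewrite ler_wpM2l ?row_bound_ge0//.
  apply: nondecreasing_cvgn_le; last exact: is_cvg_col_bound.
  by move=> n m nm; apply: nondecreasing_series => // j *; exact: col_bound_ge0.
- move=> k; apply: (@tannery R (fun N l => scaled_term N k l)
    (fun l => row_bound k * col_bound l)).
  + by move=> N l lN; exact: scaled_term_le.
  + by move=> l; exact: cvg_scaled_term.
  + exact/is_cvg_seriesZ/is_cvg_col_bound.
- rewrite (_ : (fun k => _) = (fun k => B * row_bound k)); last first.
    by apply/funext => k; rewrite mulrC.
  exact/is_cvg_seriesZ/is_cvg_row_bound.
Qed.

End HardEdge.

(** * Convergence of the correlation functions *)

Section ScaledKernel.
Context {R : realType} (alpha theta : R).
Hypotheses (theta_gt0 : 0 < theta) (alpha_gtN1 : -1 < alpha).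
Variables x y : R.
Hypotheses (x_gt0 : 0 < x) (y_gt0 : 0 < y).

Lemma lag_kernel_scaled N : (0 < N)%N ->
  N%:R `^ (- theta^-1) *
    lag_kernel alpha theta N (x / N%:R `^ (1 / theta)) (y / N%:R `^ (1 / theta)) =
  (\sum_(k < N) \sum_(l < N) scaled_term alpha theta x y N k l) *
  (y `^ alpha * expR (- (y / N%:R `^ (1 / theta)))).
Proof.
rewrite -(ltr0n R) => N0; set s := N%:R `^ (1 / theta).
have s0 : 0 < s by rewrite powR_gt0.
have pD u v : N%:R `^ (u + v) = N%:R `^ u * N%:R `^ v :> R.
  by rewrite powRD// (gt_eqF N0) implybT.
have ye : (y / s) `^ alpha = y `^ alpha * N%:R `^ (- (alpha / theta)).
  rewrite powRM ?invr_ge0 ?(ltW s0) ?(ltW y_gt0)//; congr (_ * _).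
  rewrite -powR_inv1 ?(ltW s0)// -!powRrM; congr (_ `^ _).
  by field; rewrite gt_eqF.
rewrite /lag_kernel /finite_rank_kernel !mxE exchange_big/= mulr_sumr mulr_suml.
apply: eq_bigr => l _; rewrite !mxE !mulr_suml mulr_sumr; apply: eq_bigr => k _.
rewrite !mxE ye /scaled_term -/s.
have -> : - ((alpha + 1) / theta) = - theta^-1 - alpha / theta by ring.
by rewrite pD; ring.
Qed.

Lemma cvg_lag_kernel :
  N%:R `^ (- theta^-1) *
    lag_kernel alpha theta N (x / N%:R `^ (1 / theta)) (y / N%:R `^ (1 / theta))
    @[N --> \oo] --> laguerre_kernel alpha theta x y * y `^ alpha.
Proof.
have h : (\sum_(k < N) \sum_(l < N) scaled_term alpha theta x y N k l) *
    (y `^ alpha * expR (- (y / N%:R `^ (1 / theta)))) @[N --> \oo]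
    --> laguerre_kernel alpha theta x y * (y `^ alpha * 1).
  apply: cvgM; first exact: cvg_scaled_sum.
  apply: cvgM; first exact: cvg_cst.
  have e0 : expR (- (y * 0)) = 1 :> R by rewrite mulr0 oppr0 expR0.
  rewrite -[X in _ --> X]e0.
  apply: (@cvg_comp _ _ _ (fun N => - (y / N%:R `^ (1 / theta))) expR _
    (nbhs (- (y * 0)))).
    apply: cvgN; apply: cvgM; first exact: cvg_cst.
    under eq_fun do rewrite -powRN.
    by apply: cvg_powRNn; rewrite divr_gt0.
  exact: continuous_expR.
rewrite mulr1 in h; apply: cvg_trans h; apply: near_eq_cvg; near=> N.
by rewrite lag_kernel_scaled//; near: N; exact: nbhs_infty_gt.
Unshelve. all: end_near. Qed.

End ScaledKernel.

Theorem theorem4p5 (R : realType) (theta alpha : R)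
    (theta_gt0 : 0 < theta) (alpha_gtN1 : -1 < alpha)
    (n : nat) (n_ge1 : (1 <= n)%N)
    (x : n.-tuple R) (x_gt0 : forall i : 'I_n, 0 < tnth x i) :
  (fun N : nat => 1 / (N%:R `^ (n%:R / theta)) *
      laguerre_corr alpha theta N
        [tuple tnth x i / (N%:R `^ (1 / theta)) | i < n]) @ \oo -->
    (\prod_(i < n) tnth x i `^ alpha) *
    \det (\matrix_(i < n, j < n)
            laguerre_kernel alpha theta (tnth x i) (tnth x j)).
Proof.
pose A N : 'M[R]_n := \matrix_(i, j) (N%:R `^ (- theta^-1) *
  lag_kernel alpha theta N (tnth x i / N%:R `^ (1 / theta))
    (tnth x j / N%:R `^ (1 / theta))).
have -> : (\prod_(i < n) tnth x i `^ alpha) * \det (\matrix_(i < n, j < n)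
      laguerre_kernel alpha theta (tnth x i) (tnth x j)) =
    \det (\matrix_(i < n, j < n)
      (laguerre_kernel alpha theta (tnth x i) (tnth x j) * tnth x j `^ alpha)).
  rewrite mulrC -[X in _ * X](_ : \det (diag_mx (\row_i (tnth x i `^ alpha))) = _).
    rewrite -det_mulmx; congr (\det _); apply/matrixP => i j.
    by rewrite mul_mx_diag !mxE.
  by rewrite det_diag; apply: eq_bigr => i _; rewrite mxE.
have h : \det (A N) @[N --> \oo] --> \det (\matrix_(i < n, j < n)
      (laguerre_kernel alpha theta (tnth x i) (tnth x j) * tnth x j `^ alpha)).
  apply: cvg_det => i j; rewrite mxE; under eq_fun do rewrite mxE.
  exact: cvg_lag_kernel.
apply: cvg_trans h; apply: near_eq_cvg; near=> N.
have nN : (n <= N)%N by near: N; exact: nbhs_infty_ge.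
have N0 : (0 < N)%N by exact: leq_trans n_ge1 nN.
rewrite laguerre_corrE//; last first.
  by move=> i; rewrite tnth_mktuple divr_gt0// powR_gt0// ltr0n.
have -> : 1 / N%:R `^ (n%:R / theta) = (N%:R `^ (- theta^-1)) ^+ n :> R.
  rewrite -powR_mulrn ?powR_ge0// -powRrM mul1r -powRN; congr (_ `^ _).
  by ring.
rewrite -detZ; congr (\det _); apply/matrixP => i j.
by rewrite !mxE !tnth_mktuple.
Unshelve. all: end_near. Qed.
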